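(* Let $(M,g)$ be a finite-dimensional Riemannian manifold with Levi-Civita connection $\nabla$, and equip $T^{(2)}M$ with the generalized Sasaki metric with weights $\varepsilon_1=\varepsilon_2=1$. Let $q$ be a smooth curve on $M$. Then the second jet lift $\Gamma=j^2q$ of $q$ is a geodesic on $T^{(2)}M$ if and only if $q$ is a geodesic on $M$.
   Context: **Second-order tangent bundle and jet lift.** $T^{(2)}M$ is the manifold of $2$-jets $[c]$ at $t=0$ of smooth curves $c$ on $M$, with projection $\tau^1:T^{(2)}M\to M$, $[c]\mapsto c(0)$. The second jet lift of a curve $q$ is the curve $j^2q$ in $T^{(2)}M$ whose value at $t$ is the $2$-jet of $q$ at $t$. The map $F_{1,1}([c])=(c(0),\dot c(0),\tfrac12\nabla_{\dot c}\dot c(0))$ is a diffeomorphism $T^{(2)}M\to TM\oplus TM$, identifying a curve $\Gamma$ in $T^{(2)}M$ with a triple $(q,v,y)$, where $q$ is a curve on $M$ and $v,y$ are vector fields along $q$. Under this identification $j^2q$ corresponds to $(q,\dot q,\tfrac12\nabla_{\dot q}\dot q)$. **Connection maps.** For $X\in T_uT^{(2)}M$ let $\gamma(s,t)$ be a smooth family in $M$ adapted to $X$: the $2$-jet at $t=0$ of $\gamma(0,\cdot)$ is $u$, and the $s$-derivative at $s=0$ of the $2$-jet at $t=0$ of $\gamma(s,\cdot)$ is $X$. Then $K_1(X)=\nabla_{\partial_t\gamma}\partial_s\gamma|_{(0,0)}$ and $K_2(X)=\tfrac12\nabla^2_{\partial_t\gamma}\partial_s\gamma|_{(0,0)}$.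 With $\mathcal R(X,Y)Z=\nabla_X\nabla_YZ-\nabla_Y\nabla_XZ-\nabla_{[X,Y]}Z$, for $\Gamma$ identified with $(q,v,y)$ one has $\tau^1_*\dot\Gamma=\dot q$, $K_1(\dot\Gamma)=\nabla_{\dot q}v$ and $K_2(\dot\Gamma)=\nabla_{\dot q}y+\tfrac12\mathcal R(v,\dot q)v$. **Generalized Sasaki metric (weights $1$).** The Riemannian metric on $T^{(2)}M$ given, for $X,Z\in T_uT^{(2)}M$, by $$\langle\langle X,Z\rangle\rangle^{(2)}=\langle\tau^1_*X,\tau^1_*Z\rangle+\langle K_1(X),K_1(Z)\rangle+\langle K_2(X),K_2(Z)\rangle,$$ where $\langle\cdot,\cdot\rangle=g$. ''Geodesic on $T^{(2)}M$'' means geodesic of this metric (affinely parametrized); ''geodesic on $M$'' means $\nabla_{\dot q}\dot q=0$. *)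

(* Defs.v *)
From mathcomp Require Import all_boot all_order all_algebra.
From mathcomp Require Import all_classical all_reals all_analysis.
From mathcomp Require Import ring lra.

Set Implicit Arguments.
Unset Strict Implicit.
Unset Printing Implicit Defensive.

Import Order.TTheory GRing.Theory Num.Theory.
Import numFieldNormedType.Exports.

Local Open Scope classical_set_scope.
Local Open Scope ring_scope.

Section Smoothness.
Context {R : realType}.

(* f and all its iterated directional derivatives up to order k are (Frechet)
   differentiable on U; asking this for every k is C^oo on U, V being always
   finite dimensional below. *)
Fixpoint diff_upto (V W : normedModType R) (k : nat) (U : set V) (f : V -> W) :
    Prop :=
  (forall x, U x -> differentiable f x) /\
  if k is k'.+1 then forall v : V, diff_upto k' U ('D_v f) else True.

Definition smooth_on (V W : normedModType R) (U : set V) (f : V -> W) : Prop :=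
  open U /\ forall k, diff_upto k U f.

Lemma smooth_on_cst (V W : normedModType R) (a : W) :
  smooth_on [set: V] (cst a).
Proof.
split; first exact: openT.
move=> k; elim: k a => [|k IHk] a; split=> //.
move=> v; have -> : 'D_v (cst a : V -> W) = cst 0; last exact: IHk.
by apply/funext => x; rewrite derive_cst.
Qed.

End Smoothness.

(* Covariant calculus in an open subset of R^n. Vectors are row vectors, and G
   is the matrix of components of a metric. *)
Section CoordinateCalculus.
Context {R : realType} {n : nat}.
Implicit Types (G : 'rV[R]_n -> 'M[R]_n) (x u v : 'rV[R]_n).

Definition metric_form (A : 'M[R]_n) u v : R := (u *m A *m v^T) 0 0.

Definition partial (l : 'I_n) (f : 'rV[R]_n -> R) x : R :=
  'D_(delta_mx 0 l) f x.

(* christoffel G x k i j is Gamma^k_{ij}(x). *)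
Definition christoffel G x (k i j : 'I_n) : R :=
  2^-1 * \sum_l invmx (G x) k l *
    (partial i (fun y => G y j l) x + partial j (fun y => G y i l) x
     - partial l (fun y => G y i j) x).

Definition connection_form G x u v : 'rV[R]_n :=
  \row_k \sum_i \sum_j christoffel G x k i j * u 0 i * v 0 j.

(* The covariant derivative, along the curve c, of the vector field V along c,
   for the Levi-Civita connection of G. *)
Definition cov_derive G (c V : R -> 'rV[R]_n) : R -> 'rV[R]_n :=
  fun t => derive1 V t + connection_form G (c t) (derive1 c t) (V t).

(* The Christoffel symbols are the components of the only torsion-free metric
   connection. *)
Lemma christoffelP G x (C : 'I_n -> 'I_n -> 'I_n -> R) :
  (\forall y \near x, (G y)^T = G y) -> G x \in unitmx ->
  C = christoffel G x <->
  (forall k i j, C k i j = C k j i) /\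
  (forall l i j, partial l (fun y => G y i j) x =
     \sum_m C m l i * G x m j + \sum_m C m l j * G x i m).
Proof.
move=> Gsym Gunit.
have Gxs i j : G x i j = G x j i.
  by rewrite -[in LHS](nbhs_singleton Gsym) mxE.
have pS l i j : partial l (fun y => G y i j) x = partial l (fun y => G y j i) x.
  apply: near_eq_derive.
  by apply: filterS Gsym => y Gy; rewrite -[in LHS]Gy mxE.
have lower (f : 'I_n -> R) j :
    \sum_m (\sum_l invmx (G x) m l * f l) * G x m j = f j.
  under eq_bigr do rewrite mulr_suml.
  rewrite exchange_big /=.
  have E l : \sum_m invmx (G x) m l * f l * G x m j = (j == l)%:R * f l.
    transitivity ((G x *m invmx (G x)) j l * f l); last by rewrite mulmxV// mxE.
    rewrite mxE mulr_suml; apply: eq_bigr => m _.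
    by rewrite [G x m j]Gxs; ring.
  under eq_bigr do rewrite E.
  rewrite (bigD1 j)//= eqxx mul1r big1 ?addr0// => l lj.
  by rewrite eq_sym (negbTE lj) mul0r.
have raise (f : 'I_n -> R) k :
    \sum_l invmx (G x) k l * (\sum_m f m * G x m l) = f k.
  under eq_bigr do rewrite mulr_sumr.
  rewrite exchange_big /=.
  have E m : \sum_l invmx (G x) k l * (f m * G x m l) = (k == m)%:R * f m.
    transitivity ((invmx (G x) *m G x) k m * f m); last by rewrite mulVmx// mxE.
    rewrite mxE mulr_suml; apply: eq_bigr => l _.
    by rewrite [G x m l]Gxs; ring.
  under eq_bigr do rewrite E.
  rewrite (bigD1 k)//= eqxx mul1r big1 ?addr0// => l lj.
  by rewrite eq_sym (negbTE lj) mul0r.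
split=> [->|[Csym Cmet]].
  split=> [k i j|l i j].
    rewrite /christoffel; congr (_ * _); apply: eq_bigr => l _.
    by rewrite (pS l i j); ring.
  have E a b : \sum_m christoffel G x m l a * G x m b =
      2^-1 * (partial l (fun y => G y a b) x + partial a (fun y => G y l b) x
              - partial b (fun y => G y l a) x).
    rewrite /christoffel.
    under eq_bigr do rewrite -mulrA.
    by rewrite -mulr_sumr lower.
  under [X in _ + X]eq_bigr do rewrite [G x i _]Gxs.
  by rewrite !E (pS l j i); lra.
apply/funext => k; apply/funext => i; apply/funext => j.
rewrite /christoffel -[LHS](raise (fun m => C m i j)) mulr_sumr.
apply: eq_bigr => l _; rewrite !Cmet.
have Ex a b c : \sum_m C m a b * G x c m = \sum_m C m a b * G x m c.
  by apply: eq_bigr => m _; rewrite [G x c m]Gxs.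
have Cx a b c : \sum_m C m a b * G x m c = \sum_m C m b a * G x m c.
  by apply: eq_bigr => m _; rewrite [C m a b]Csym.
rewrite !Ex (Cx l i) (Cx l j) (Cx j i).
rewrite mulrCA; congr (_ * _); lra.
Qed.

End CoordinateCalculus.

Section Manifolds.
Context {R : realType}.

Record chart (n : nat) (X : Type) := Chart {
  chart_dom : set X;
  chart_map :> X -> 'rV[R]_n }.

Record smoothManifold (n : nat) := SmoothManifold {
  carrier :> topologicalType;
  chart_index : Type;
  charts : chart_index -> chart n carrier;
  chart_inv : chart_index -> 'rV[R]_n -> carrier;
  manifold_hausdorff : hausdorff_space carrier;
  manifold_second_countable : @second_countable carrier;
  charts_cover : forall p, exists i, chart_dom (charts i) p;
  chart_dom_open : forall i, open (chart_dom (charts i));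
  chart_image_open : forall i, open (charts i @` chart_dom (charts i));
  chart_mapK : forall i p, chart_dom (charts i) p ->
    chart_inv i (charts i p) = p;
  chart_map_continuous : forall i p, chart_dom (charts i) p ->
    {for p, continuous (charts i)};
  chart_inv_continuous : forall i x, (charts i @` chart_dom (charts i)) x ->
    {for x, continuous (chart_inv i)};
  transition_smooth : forall i j,
    smooth_on (charts i @` (chart_dom (charts i) `&` chart_dom (charts j)))
              (charts j \o chart_inv i) }.

(* A Riemannian metric, given by its components in the charts. *)
Record riemannianMetric (n : nat) (M : smoothManifold n) := RiemannianMetric {
  metric_coef :> chart_index M -> 'rV[R]_n -> 'M[R]_n;
  metric_smooth : forall i (a b : 'I_n),
    smooth_on (charts i @` chart_dom (charts i))
              (fun x => metric_coef i x a b);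
  metric_sym : forall i x, (charts i @` chart_dom (charts i)) x ->
    (metric_coef i x)^T = metric_coef i x;
  metric_posdef : forall i x, (charts i @` chart_dom (charts i)) x ->
    forall v : 'rV[R]_n, v != 0 -> 0 < metric_form (metric_coef i x) v v;
  metric_transition : forall i j p,
    chart_dom (charts i) p -> chart_dom (charts j) p ->
    forall u v : 'rV[R]_n,
      metric_form (metric_coef i (charts i p)) u v =
      metric_form (metric_coef j (charts j p))
        ('D_u (charts j \o chart_inv i) (charts i p))
        ('D_v (charts j \o chart_inv i) (charts i p)) }.

(* Curves are total functions R -> X, of which only the restriction to some open
   interval is meaningful. The notions below are used both for M and for its
   second-order tangent bundle. *)
Section Curves.
Context (n : nat) (X J : Type) (A : J -> chart n X).

Definition smooth_curve_at (c : R -> X) (t : R) : Prop :=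
  forall i, chart_dom (A i) (c t) ->
  exists2 U : set R, U t /\ U `<=` c @^-1` chart_dom (A i) &
    smooth_on U (A i \o c).

Definition smooth_curve_on (I : set R) (c : R -> X) : Prop :=
  forall t, I t -> smooth_curve_at c t.

(* c is smooth and nabla_{c'} c' = 0 on I, for the metric with components G. *)
Definition geodesic_on (G : J -> 'rV[R]_n -> 'M[R]_n) (I : set R) (c : R -> X) :
    Prop :=
  smooth_curve_on I c /\
  forall t i, I t -> chart_dom (A i) (c t) ->
    cov_derive (G i) (A i \o c) (derive1 (A i \o c)) t = 0.

Lemma smooth_curve_cst (p : X) t : smooth_curve_at (cst p) t.
Proof.
by move=> i Aip; exists setT; [split|exact: (@smooth_on_cst R R _ (A i p))].
Qed.

End Curves.
End Manifolds.
Arguments chart R n X : clear implicits.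
Arguments smoothManifold R n : clear implicits.

Section SecondOrderTangentBundle.
Context {R : realType} {n : nat} (M : smoothManifold R n).

(* c' is smooth near 0 and has the same 2-jet at 0 as c. *)
Definition same_jet (c c' : R -> M) : Prop :=
  [/\ smooth_curve_at (@charts R n M) c' 0, c' 0 = c 0 &
      forall i, chart_dom (charts i) (c 0) ->
        derive1 (charts i \o c') 0 = derive1 (charts i \o c) 0 /\
        derive1n 2 (charts i \o c') 0 = derive1n 2 (charts i \o c) 0].

(* A 2-jet is an equivalence class of curves. *)
Record T2 := Jet {
  jet_class : set (R -> M);
  jet_classP : exists2 c, smooth_curve_at (@charts R n M) c 0 &
                          jet_class = same_jet c }.

Definition jet_of (c : R -> M) (cs : smooth_curve_at (@charts R n M) c 0) : T2 :=
  @Jet (same_jet c) (ex_intro2 _ _ c cs erefl).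

Definition jet_repr (J : T2) : R -> M := s2val (cid2 (jet_classP J)).

Definition T2_proj (J : T2) : M := jet_repr J 0.

(* The value is irrelevant when c is not smooth near 0: the jet of a constant
   curve is then used. *)
Definition jet2 (c : R -> M) : T2 :=
  match pselect (smooth_curve_at (@charts R n M) c 0) with
  | left cs => jet_of cs
  | right _ => jet_of (@smooth_curve_cst R n M _ (@charts R n M) (c 0) 0)
  end.

Definition jet_lift (q : R -> M) : R -> T2 := fun t => jet2 (fun s => q (t + s)).

Definition jet_coord (x : R -> 'rV[R]_n) : 'rV[R]_(n + n + n) :=
  row_mx (row_mx (x 0) (derive1 x 0)) (derive1n 2 x 0).

(* The charts (x, x', x'') of T2 induced by those of M. *)
Definition T2_charts (i : chart_index M) : chart R (n + n + n) T2 :=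
  Chart [set J | chart_dom (charts i) (T2_proj J)]
        (fun J => jet_coord (charts i \o jet_repr J)).

Lemma jet2_reprP (c : R -> M) :
  smooth_curve_at (@charts R n M) c 0 -> same_jet c (jet_repr (jet2 c)).
Proof.
move=> cs; have Jc : jet_class (jet2 c) = same_jet c.
  by rewrite /jet2; case: pselect => [?|/(_ cs)[]]; first exact: erefl.
rewrite /jet_repr; case: cid2 => /= d ds Jd.
move: Jc; rewrite {}Jd => <-; split=> //.
Qed.

Lemma T2_charts_jet2 (c : R -> M) (i : chart_index M) :
  smooth_curve_at (@charts R n M) c 0 -> chart_dom (charts i) (c 0) ->
  T2_charts i (jet2 c) = jet_coord (charts i \o c).
Proof.
move=> /jet2_reprP[_ c0 h] ic.
by rewrite /= /jet_coord; have [-> ->] := h i ic; rewrite /= c0.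
Qed.

End SecondOrderTangentBundle.

(* The generalized Sasaki metric (weights 1) in a chart (x, x', x'') of T2 M
   induced by a chart of M in which the metric has components G. *)
Section SasakiMetric.
Context {R : realType} {n : nat} (G : 'rV[R]_n -> 'M[R]_n).
Implicit Types u X Z w : 'rV[R]_(n + n + n).

Definition jet_pos w : 'rV[R]_n := lsubmx (lsubmx w).
Definition jet_vel w : 'rV[R]_n := rsubmx (lsubmx w).
Definition jet_acc w : 'rV[R]_n := rsubmx w.

(* A family gamma(s,t) adapted to the tangent vector X at u: the 2-jet at t = 0
   of gamma(s,.) is u + s X, see adapted_familyP. *)
Definition adapted_family u X (s t : R) : 'rV[R]_n :=
  let w := u + s *: X in
  jet_pos w + t *: jet_vel w + (2^-1 * t ^+ 2) *: jet_acc w.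

Definition variation_field u X (t : R) : 'rV[R]_n :=
  derive1 (fun s => adapted_family u X s t) 0.

(* Coordinates of the tangent map of the projection T2 M -> M. *)
Definition T2_proj_tangent X : 'rV[R]_n := jet_pos X.

Definition K1 u X : 'rV[R]_n :=
  cov_derive G (adapted_family u X 0) (variation_field u X) 0.

Definition K2 u X : 'rV[R]_n :=
  2^-1 *: cov_derive G (adapted_family u X 0)
            (cov_derive G (adapted_family u X 0) (variation_field u X)) 0.

Definition sasaki_form u X Z : R :=
  let g := metric_form (G (jet_pos u)) in
  g (T2_proj_tangent X) (T2_proj_tangent Z) +
  g (K1 u X) (K1 u Z) + g (K2 u X) (K2 u Z).

Definition sasaki_coef u : 'M[R]_(n + n + n) :=
  \matrix_(a, b) sasaki_form u (delta_mx 0 a) (delta_mx 0 b).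

Let derive1_quadratic (a b c : 'rV[R]_n) :
  derive1 (fun t : R => a + t *: b + (2^-1 * t ^+ 2) *: c) =
  fun t => b + t *: c.
Proof.
have dZ (f : R -> R) (w : 'rV[R]_n) (t df : R) :
    is_derive t (1 : R) f df -> is_derive t (1 : R) (fun s => f s *: w) (df *: w).
  move=> [/derivable1_diffP fd <-].
  apply: DeriveDef; first exact/derivable1_diffP/differentiableZl.
  by rewrite !deriveE//; [rewrite diffZl|exact: differentiableZl].
apply/funext => t; rewrite derive1E.
have h1 : is_derive t (1 : R) (fun s : R => s *: b) (1 *: b) by exact: dZ.
have h2 : is_derive t (1 : R) (fun s : R => (2^-1 * s ^+ 2) *: c) (t *: c).
  apply: dZ; apply: is_derive_eq.
  by rewrite /GRing.scale/=; lra.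
have h0 : is_derive t (1 : R) (cst a : R -> 'rV[R]_n) 0 by exact: is_derive_cst.
have := is_deriveD (is_deriveD h0 h1) h2.
by move=> /(@derive_val _ _ _ _ _ _ _) ->; rewrite add0r scale1r.
Qed.

Lemma adapted_familyP u X (s : R) :
  jet_coord (adapted_family u X s) = u + s *: X.
Proof.
set w := u + s *: X.
have d1 : derive1 (adapted_family u X s) = fun t => jet_vel w + t *: jet_acc w.
  exact: derive1_quadratic.
have d2 : derive1n 2 (adapted_family u X s) = fun t => jet_acc w.
  rewrite derive1nS /= d1; have := derive1_quadratic (jet_vel w) (jet_acc w) 0.
  under eq_fun do rewrite scaler0 addr0.
  by move=> ->; apply/funext => t; rewrite scaler0 addr0.
rewrite /jet_coord d1 d2 /adapted_family -/w expr0n mulr0 !scale0r !addr0.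
by rewrite /jet_pos /jet_vel /jet_acc !hsubmxK.
Qed.

End SasakiMetric.

Definition sasaki_metric (R : realType) (n : nat) (M : smoothManifold R n)
    (g : riemannianMetric M) (i : chart_index M) :
    'rV[R]_(n + n + n) -> 'M[R]_(n + n + n) :=
  sasaki_coef (g i).

(* Main.v *)
Require Import Defs.
From mathcomp Require Import all_boot all_order all_algebra.
From mathcomp Require Import all_classical all_reals all_analysis.
From mathcomp Require Import ring lra.

(** Everything is computed in a chart. Write x for the curve q, D for the
    covariant derivative along it, and J = D x', J1 = D J, J2 = D J1. Along the
    jet lift w = (x, x', x'') the connection maps take the values K1(w') = J and
    K2(w') = J1 / 2.

    If w is a geodesic, its Euler-Lagrange equation in the directions (0, 0, z)
    only involves K2 and says that J2 = 0. The speed of w is constant, which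
    given J2 = 0 means that <J, x'> + <J1, J> = 0. Differentiating this three
    times along x, each time with J2 = 0, gives successively
    <J1, x'> + |J|^2 + |J1|^2 = 0, then <J1, J> = 0, then |J1|^2 = 0; the first
    of these three is then |J|^2 = 0.

    Conversely, if J = 0, then K1(w') and K2(w') vanish, and the Euler-Lagrange
    equations of w reduce to those of x. *)

Set Implicit Arguments.
Unset Strict Implicit.
Unset Printing Implicit Defensive.

Import Order.TTheory GRing.Theory Num.Theory.
Import numFieldNormedType.Exports.

Local Open Scope classical_set_scope.
Local Open Scope ring_scope.

(** * Algebra of smooth functions *)

Section SmoothFunctions.
Context {R : realType}.

(** Near x the difference [g - f] vanishes, so it is a constant plus a little-o with zero linear
    part; then [g = f + (g - f)] is a sum of differentiable maps. *)
Lemma near_eq_differentiable (V W : normedModType R) (f g : V -> W) (x : V) :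
  (\near x, f x = g x) -> differentiable f x -> differentiable g x.
Proof.
move=> fg df.
have c0 : continuous (\0 : V -> W) by exact: cst_continuous.
have o0 : (g - f) \o shift x = cst ((g - f) x) + \0 +o_ 0 id.
  apply/eqaddoP => _/posnumP[e].
  have fgx := nbhs_singleton fg.
  move: fg; rewrite (near_shift 0) subr0; apply: filterS => h /= fgh.
  by rewrite !fctE /= -fgh -fgx !subrr addr0 subrr normr0 mulr_ge0.
have dh : differentiable (g - f) x.
  by apply/diff_locallyP; rewrite (diff_unique c0 o0).
have -> : g = f + (g - f) by rewrite addrC subrK.
exact: differentiableD.
Qed.

(** Openness of U makes equality on U an equality near each of its points, which passes to
    directional derivatives and feeds the induction. *)
Lemma diff_upto_eq (V W : normedModType R) (U : set V) (f g : V -> W) k :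
  open U -> {in U, f =1 g} -> diff_upto k U f -> diff_upto k U g.
Proof.
move=> oU; elim: k f g => [|k IHk] f g fg [df Df];
  (have nfg x : U x -> \near x, f x = g x by
    move=> Ux; apply: filterS (open_nbhs_nbhs (conj oU Ux)) => y Uy;
    apply: fg; rewrite inE);
  (split=> [x Ux|]; first by apply: near_eq_differentiable (df x Ux); exact: nfg).
  by [].
move=> v; apply: IHk (Df v) => x /set_mem Ux.
exact/near_eq_derive/nfg.
Qed.

Lemma diff_uptoW (V W : normedModType R) (U : set V) (f : V -> W) k :
  diff_upto k.+1 U f -> diff_upto k U f.
Proof.
elim: k f => [|k IHk] f [df Df]; split=> // v.
exact: IHk (Df v).
Qed.

Lemma diff_uptoD (V W : normedModType R) (U : set V) (f g : V -> W) k :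
  open U -> diff_upto k U f -> diff_upto k U g ->
  diff_upto k U (fun x => f x + g x).
Proof.
move=> oU; elim: k f g => [|k IHk] f g [df Df] [dg Dg];
  (split=> [x Ux|]; first exact: (differentiableD (df x Ux) (dg x Ux))).
  by [].
move=> v; apply: diff_upto_eq oU _ (IHk _ _ (Df v) (Dg v)) => x /set_mem Ux.
by rewrite (@deriveD _ _ _ f g)//; apply: diff_derivable; [exact: df|exact: dg].
Qed.

Lemma diff_uptoM (V : normedModType R) (U : set V) (f g : V -> R) k :
  open U -> diff_upto k U f -> diff_upto k U g ->
  diff_upto k U (fun x => f x * g x).
Proof.
move=> oU; elim: k f g => [|k IHk] f g fk gk; have [df Df] := fk;
  have [dg Dg] := gk;
  (split=> [x Ux|]; first exact: (differentiableM (df x Ux) (dg x Ux))).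
  by [].
move=> v.
have := diff_uptoD oU (IHk _ _ (diff_uptoW fk) (Dg v))
  (IHk _ _ (diff_uptoW gk) (Df v)).
apply: diff_upto_eq oU _ => x /set_mem Ux.
by rewrite (@deriveM _ _ f g)//; apply: diff_derivable; [exact: df|exact: dg].
Qed.

Lemma diff_upto_subset (V W : normedModType R) (U U' : set V) (f : V -> W) k :
  U' `<=` U -> diff_upto k U f -> diff_upto k U' f.
Proof.
move=> sU; elim: k f => [|k IHk] f [df Df]; split=> //.
- by move=> x Ux; exact/df/sU.
- by move=> x Ux; exact/df/sU.
- by move=> v; exact: (IHk _ (Df v)).
Qed.

(** The derivative of 1/f is -(1/f)(1/f) f', where the induction hypothesis covers 1/f one order
    lower; f itself stays fixed in the induction. *)
Lemma diff_uptoV (V : normedModType R) (U : set V) (f : V -> R) k :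
  open U -> {in U, forall x, f x != 0} ->
  diff_upto k U f -> diff_upto k U (fun x => (f x)^-1).
Proof.
move=> oU f0; elim: k => [|k IHk] fk; have [df Df] := fk;
  (split=> [x Ux|]; first by
     apply: (differentiableV (df x Ux)); apply: f0; rewrite inE).
  by [].
move=> v; have fVk := IHk (diff_uptoW fk).
have m1 : diff_upto k U (cst (-1) : V -> R).
  exact: diff_upto_subset (@subsetT _ U) ((@smooth_on_cst R V R (-1)).2 k).
have := diff_uptoM oU (diff_uptoM oU m1 (diff_uptoM oU fVk fVk)) (Df v).
apply: diff_upto_eq oU _ => x /[dup] xU /set_mem Ux.
rewrite (@deriveV _ _ f)//; [|exact: f0|exact/diff_derivable/df].
by rewrite -exprVn expr2 mulN1r.
Qed.

Lemma smooth_on_subset (V W : normedModType R) (U U' : set V) (f : V -> W) :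
  open U' -> U' `<=` U -> smooth_on U f -> smooth_on U' f.
Proof. by move=> oU' sU [oU fU]; split=> // k; exact: diff_upto_subset sU _. Qed.

Lemma smooth_onC (V W : normedModType R) (U : set V) (a : W) :
  open U -> smooth_on U (fun=> a).
Proof.
move=> oU.
by apply: smooth_on_subset oU (@subsetT _ U) (@smooth_on_cst R V W a).
Qed.

Lemma smooth_on_eq (V W : normedModType R) (U : set V) (f g : V -> W) :
  {in U, f =1 g} -> smooth_on U f -> smooth_on U g.
Proof. by move=> fg [oU fU]; split=> // k; exact: diff_upto_eq fg (fU k). Qed.

Lemma smooth_onD (V W : normedModType R) (U : set V) (f g : V -> W) :
  smooth_on U f -> smooth_on U g -> smooth_on U (fun x => f x + g x).
Proof. by move=> [oU fU] [_ gU]; split=> // k; exact: diff_uptoD. Qed.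

Lemma smooth_onM (V : normedModType R) (U : set V) (f g : V -> R) :
  smooth_on U f -> smooth_on U g -> smooth_on U (fun x => f x * g x).
Proof. by move=> [oU fU] [_ gU]; split=> // k; exact: diff_uptoM. Qed.

Lemma smooth_onV (V : normedModType R) (U : set V) (f : V -> R) :
  {in U, forall x, f x != 0} -> smooth_on U f ->
  smooth_on U (fun x => (f x)^-1).
Proof. by move=> f0 [oU fU]; split=> // k; exact: diff_uptoV. Qed.

Lemma smooth_onN (V : normedModType R) (U : set V) (f : V -> R) :
  smooth_on U f -> smooth_on U (fun x => - f x).
Proof.
move=> fU; have := smooth_onM (smooth_onC (-1 : R) fU.1) fU.
by apply: smooth_on_eq => x _; rewrite mulN1r.
Qed.

Lemma smooth_on_sum (V W : normedModType R) (U : set V) (J : Type) (r : seq J)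
    (P : pred J) (f : J -> V -> W) :
  open U -> (forall j, smooth_on U (f j)) ->
  smooth_on U (fun x => \sum_(j <- r | P j) f j x).
Proof.
move=> oU fU; elim: r => [|j r IHr].
  by under eq_fun do rewrite big_nil; exact: smooth_onC.
under eq_fun do rewrite big_cons.
by case: (P j) => //; exact: smooth_onD.
Qed.

Lemma smooth_on_prod (V : normedModType R) (U : set V) (J : Type) (r : seq J)
    (P : pred J) (f : J -> V -> R) :
  open U -> (forall j, smooth_on U (f j)) ->
  smooth_on U (fun x => \prod_(j <- r | P j) f j x).
Proof.
move=> oU fU; elim: r => [|j r IHr].
  by under eq_fun do rewrite big_nil; exact: smooth_onC.
under eq_fun do rewrite big_cons.
by case: (P j) => //; exact: smooth_onM.
Qed.

Lemma smooth_on_differentiable (V W : normedModType R) (U : set V) (f : V -> W) x :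
  smooth_on U f -> U x -> differentiable f x.
Proof. by move=> [_ /(_ 0%N)[+ _]]; exact. Qed.

Lemma smooth_on_derivable (V W : normedModType R) (U : set V) (f : V -> W) x v :
  smooth_on U f -> U x -> derivable f x v.
Proof. by move=> fU Ux; apply/diff_derivable/(smooth_on_differentiable fU). Qed.

Lemma smooth_on_derive (V W : normedModType R) (U : set V) (f : V -> W) v :
  smooth_on U f -> smooth_on U ('D_v f).
Proof. by move=> [oU fU]; split=> // k; have [_] := fU k.+1; exact. Qed.

Lemma smooth_on_derive1 (W : normedModType R) (U : set R) (f : R -> W) :
  smooth_on U f -> smooth_on U (derive1 f).
Proof.
move=> fU; have := smooth_on_derive (1 : R) fU.
by apply: smooth_on_eq => x _; rewrite derive1E.
Qed.

(** The derivative of a linear map in a fixed direction is constant, hence smooth. *)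
Lemma smooth_on_linear (V W : normedModType R) (f : {linear V -> W}) :
  continuous f -> smooth_on [set: V] f.
Proof.
move=> fc; split=> [|k]; first exact: openT.
have Df v : 'D_v f = cst (f v).
  apply/funext => x; rewrite deriveE; last exact: linear_differentiable.
  by rewrite diff_lin.
case: k => [|k]; split=> //; first by move=> x _; exact: linear_differentiable.
- by move=> x _; exact: linear_differentiable.
- by move=> v; rewrite Df; apply: (@smooth_on_cst R V W (f v)).2.
Qed.

Lemma smooth_on_coord (n : nat) (U : set 'rV[R]_n) (j : 'I_n) :
  open U -> smooth_on U (fun v : 'rV[R]_n => v 0 j).
Proof.
move=> oU; apply: (@smooth_on_subset _ _ setT) => //.
have @f : {linear 'rV[R]_n -> R}.
  by exists (fun v : 'rV[R]_n => v 0 j); do 2![eexists]; do ?[constructor];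
     rewrite ?mxE// => ? *; rewrite ?mxE//; move=> ?; rewrite !mxE.
by apply: (@smooth_on_linear _ _ f); exact: coord_continuous.
Qed.

Lemma diff_uptoZl (V W : normedModType R) (U : set V) (f : V -> R) (w : W) k :
  open U -> diff_upto k U f -> diff_upto k U (fun x => f x *: w).
Proof.
move=> oU; elim: k f => [|k IHk] f [df Df];
  (split=> [x Ux|]; first exact: (differentiableZl w (df x Ux))).
  by [].
move=> v; apply: diff_upto_eq oU _ (IHk _ (Df v)) => x /set_mem Ux.
have dx := df x Ux.
by rewrite !deriveE//; [rewrite diffZl|exact: differentiableZl].
Qed.

Lemma smooth_on_row (V : normedModType R) n (U : set V) (f : V -> 'rV[R]_n) :
  open U -> (forall j, smooth_on U (fun x => f x 0 j)) -> smooth_on U f.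
Proof.
move=> oU fU.
have -> : f = fun x => \sum_(j < n) f x 0 j *: delta_mx 0 j.
  by apply/funext => x; exact: row_sum_delta.
apply: smooth_on_sum => // j; split=> // k.
exact/(diff_uptoZl (delta_mx 0 j) oU)/(fU j).2.
Qed.

Lemma derive_row (V : normedModType R) n (f : V -> 'rV[R]_n) x v j :
  derivable f x v -> ('D_v f x) 0 j = 'D_v (fun y => f y 0 j) x.
Proof. by move=> df; rewrite derive_mx// mxE. Qed.

Lemma smooth_on_row_coord (V : normedModType R) n (U : set V)
    (f : V -> 'rV[R]_n) j :
  smooth_on U f -> smooth_on U (fun x => f x 0 j).
Proof.
move=> [oU fU]; split=> // k; have {fU} := fU k.
have dj (g : V -> 'rV[R]_n) x : differentiable g x ->
    differentiable (fun y => g y 0 j) x.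
  by move=> gx; apply: differentiable_comp gx (differentiable_coord _ _ _).
elim: k f => [|k IHk] f [df Df]; (split=> [x Ux|]; first exact/dj/df).
  by [].
move=> v; apply: diff_upto_eq oU _ (IHk _ (Df v)) => x /set_mem Ux.
by rewrite derive_row//; exact/diff_derivable/df.
Qed.

Lemma derive_comp_row (V : normedModType R) n (c : V -> 'rV[R]_n)
    (f : 'rV[R]_n -> R) x v :
  differentiable c x -> differentiable f (c x) ->
  'D_v (fun y => f (c y)) x = \sum_l ('D_v c x) 0 l * partial l f (c x).
Proof.
move=> dc df; have dfc := differentiable_comp dc df.
rewrite (@deriveE _ _ _ (f \o c))// diff_comp//= -(deriveE v dc).
rewrite [in LHS](row_sum_delta ('D_v c x)) linear_sum.
by apply: eq_bigr => l _; rewrite linearZ /partial -(deriveE _ df).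
Qed.

(** By the chain rule a derivative of the composite is a sum of products of c' with partial
    derivatives of f along c. Keeping f smooth of all orders in the induction lets the hypothesis
    apply to those partial derivatives. *)
Lemma smooth_on_comp (V : normedModType R) n (U : set V) (D : set 'rV[R]_n)
    (c : V -> 'rV[R]_n) (f : 'rV[R]_n -> R) :
  smooth_on U c -> {homo c : x / U x >-> D x} -> smooth_on D f ->
  smooth_on U (fun x => f (c x)).
Proof.
move=> cU cUD fD; split=> [|k]; first exact: cU.1.
elim: k f fD => [|k IHk] f fD;
  (split=> [x Ux|]; first exact: (differentiable_comp
    (smooth_on_differentiable cU Ux) (smooth_on_differentiable fD (cUD _ Ux)))).
  by [].
move=> v.
have sU : diff_upto k U (fun x => \sum_l ('D_v c x) 0 l * partial l f (c x)).
  (* Only order k is available at this point, so the sum is handled by induction on the list of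
     indices instead of through [smooth_on_sum]. *)
  suff h (r : seq 'I_n) :
      diff_upto k U (fun x => \sum_(l <- r) ('D_v c x) 0 l * partial l f (c x)).
    exact: h.
  elim: r => [|l r IHr].
    under eq_fun do rewrite big_nil.
    exact: (smooth_onC (0 : R) cU.1).2.
  under eq_fun do rewrite big_cons.
  apply: diff_uptoD cU.1 _ IHr; apply: diff_uptoM cU.1 _ _.
    exact: (smooth_on_row_coord l (smooth_on_derive v cU)).2.
  by apply: IHk; exact: smooth_on_derive.
apply: diff_upto_eq cU.1 _ sU => x /set_mem Ux.
rewrite derive_comp_row//.
  exact: smooth_on_differentiable cU Ux.
exact: smooth_on_differentiable fD (cUD _ Ux).
Qed.

Lemma smooth_on_det (V : normedModType R) n (U : set V) (A : V -> 'M[R]_n) :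
  open U -> (forall i j, smooth_on U (fun x => A x i j)) ->
  smooth_on U (fun x => \det (A x)).
Proof.
move=> oU AU; apply: smooth_on_sum => // s.
apply: smooth_onM; first exact: smooth_onC.
exact: smooth_on_prod.
Qed.

(** Cramer's rule: the entries of the inverse are cofactors divided by a nonvanishing determinant,
    and both are polynomial in the entries. *)
Lemma smooth_on_invmx (V : normedModType R) n (U : set V) (A : V -> 'M[R]_n) :
  open U -> (forall i j, smooth_on U (fun x => A x i j)) ->
  {in U, forall x, A x \in unitmx} ->
  forall i j, smooth_on U (fun x => invmx (A x) i j).
Proof.
move=> oU AU Au i j.
have dU : smooth_on U (fun x => (\det (A x))^-1).
  apply: smooth_onV; last exact: smooth_on_det.
  by move=> x /Au; rewrite unitmxE unitfE.
have cU : smooth_on U (fun x => cofactor (A x) j i).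
  apply: smooth_onM; first exact: smooth_onC.
  apply: smooth_on_det => // a b.
  by under eq_fun do rewrite !mxE; exact: AU.
apply: smooth_on_eq (smooth_onM dU cU) => x xU.
by rewrite /invmx Au// !mxE.
Qed.

End SmoothFunctions.

(** * Compatibility of the metric and the connection *)

(** As f is affine on the line through a directed by v, its difference quotient equals b for every
    nonzero h. This computes derivatives along jet directions in which the connection maps are
    affine. *)
Lemma derive_line {R : realType} (V W : normedModType R) (f : V -> W) a v b :
  (forall h : R, f (h *: v + a) = f a + h *: b) -> 'D_v f a = b.
Proof.
move=> fE; rewrite /derive; apply: cvg_lim => //.
apply: cvg_near_cst; near=> h.
rewrite /= fE [f a + _]addrC addrK scalerA mulVf ?scale1r//.
by near: h; exact: nbhs_dnbhs_neq.
Unshelve. all: by end_near. Qed.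

Lemma is_derive_bigsum {R : realType} (V W : normedModType R) m (f : 'I_m -> V -> W)
    (df : 'I_m -> W) x v :
  (forall i, is_derive x v (f i) (df i)) ->
  is_derive x v (fun y => \sum_i f i y) (\sum_i df i).
Proof.
move=> fd; have := is_derive_sum fd.
by congr is_derive; apply/funext => y; rewrite fct_sumE.
Qed.

Lemma is_derive_row {R : realType} (V : normedModType R) m (f : V -> 'rV[R]_m) x v df j :
  is_derive x v f df -> is_derive x v (fun y => f y 0 j) (df 0 j).
Proof.
move=> [fd <-]; rewrite derive_row//; apply: derivableP.
by move/derivable_mxP : fd; exact.
Qed.

Section MetricForm.
Context {R : realType} {n : nat}.
Implicit Types (A B : 'M[R]_n) (u v : 'rV[R]_n).

Lemma metric_formE A u v :
  metric_form A u v = \sum_i \sum_j u 0 i * A i j * v 0 j.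
Proof.
rewrite /metric_form mxE exchange_big; apply: eq_bigr => j _ /=.
by rewrite mxE mulr_suml; apply: eq_bigr => i _; rewrite mxE.
Qed.

Lemma metric_formDl A u1 u2 v :
  metric_form A (u1 + u2) v = metric_form A u1 v + metric_form A u2 v.
Proof. by rewrite /metric_form !mulmxDl mxE. Qed.

Lemma metric_formZl A a u v : metric_form A (a *: u) v = a * metric_form A u v.
Proof. by rewrite /metric_form -!scalemxAl mxE. Qed.

Lemma metric_formDr A u v1 v2 :
  metric_form A u (v1 + v2) = metric_form A u v1 + metric_form A u v2.
Proof. by rewrite /metric_form linearD mulmxDr mxE. Qed.

Lemma metric_formZr A a u v : metric_form A u (a *: v) = a * metric_form A u v.
Proof. by rewrite /metric_form linearZ -scalemxAr mxE. Qed.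

Lemma metric_form0l A v : metric_form A 0 v = 0.
Proof. by rewrite /metric_form !mul0mx mxE. Qed.

Lemma metric_form0r A v : metric_form A v 0 = 0.
Proof. by rewrite /metric_form trmx0 mulmx0 mxE. Qed.

Lemma metric_form_suml A (J : finType) (f : J -> 'rV[R]_n) v :
  metric_form A (\sum_j f j) v = \sum_j metric_form A (f j) v.
Proof. by rewrite /metric_form !mulmx_suml summxE. Qed.

Lemma metric_form_sumr A (J : finType) (f : J -> 'rV[R]_n) v :
  metric_form A v (\sum_j f j) = \sum_j metric_form A v (f j).
Proof. by rewrite /metric_form linear_sum mulmx_sumr summxE. Qed.

Lemma metric_formC A u v : A^T = A -> metric_form A u v = metric_form A v u.
Proof.
move=> As; rewrite /metric_form -[in LHS]As -[LHS]trace_mx11 -[RHS]trace_mx11.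
by rewrite -mxtrace_tr !trmx_mul !trmxK mulmxA.
Qed.

End MetricForm.

(** * Local metrics and their Levi-Civita connection *)

Section MetricOn.
Context {R : realType}.

(** Isolated so that the same calculus serves twice: for the metric of M in a chart and for the
    Sasaki metric in the induced chart of the jet bundle. *)
Definition metric_on n (D : set 'rV[R]_n) (G : 'rV[R]_n -> 'M[R]_n) : Prop :=
  [/\ open D, forall i j, smooth_on D (fun x => G x i j),
      forall x, D x -> (G x)^T = G x &
      forall x, D x -> forall v, v != 0 -> 0 < metric_form (G x) v v].

Variables (n : nat) (D : set 'rV[R]_n) (G : 'rV[R]_n -> 'M[R]_n).
Hypothesis GD : metric_on D G.
Implicit Types x u v w : 'rV[R]_n.

Let oD : open D. Proof. by case: GD. Qed.
Let sD i j : smooth_on D (fun x => G x i j). Proof. by case: GD. Qed.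
Let symD x : D x -> (G x)^T = G x. Proof. by case: GD => _ _ + _; exact. Qed.
Let posD x v : D x -> v != 0 -> 0 < metric_form (G x) v v.
Proof. by case: GD => _ _ _ + Dx; exact. Qed.

Lemma metric_ge0 x v : D x -> 0 <= metric_form (G x) v v.
Proof.
move=> Dx; have [->|v0] := eqVneq v 0; first by rewrite metric_form0l.
exact/ltW/posD.
Qed.

Lemma metric_eq0 x v : D x -> metric_form (G x) v v = 0 -> v = 0.
Proof. by move=> Dx; have [//|/(posD Dx)/lt0r_neq0/eqP] := eqVneq v 0. Qed.

(** A nonzero row vector in the kernel would have zero square norm. *)
Lemma metric_unitmx x : D x -> G x \in unitmx.
Proof.
move=> Dx; rewrite unitmxE unitfE; apply/negP => /det0P[v v0 vG].
by have := posD Dx v0; rewrite /metric_form vG mul0mx mxE ltxx.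
Qed.

Lemma smooth_on_christoffel k i j : smooth_on D (fun x => christoffel G x k i j).
Proof.
apply: smooth_onM; first exact: smooth_onC.
apply: smooth_on_sum => // l; apply: smooth_onM.
  by apply: smooth_on_invmx => // x /set_mem; exact: metric_unitmx.
apply: smooth_onD; last exact/smooth_onN/smooth_on_derive.
by apply: smooth_onD; exact: smooth_on_derive.
Qed.

Lemma christoffel_spec x : D x ->
  (forall k i j, christoffel G x k i j = christoffel G x k j i) /\
  (forall l i j, partial l (fun y => G y i j) x =
     \sum_m christoffel G x m l i * G x m j +
     \sum_m christoffel G x m l j * G x i m).
Proof.
move=> Dx; apply/christoffelP; [|exact: metric_unitmx|by []].
by apply: filterS (open_nbhs_nbhs (conj oD Dx)) => y; exact: symD.
Qed.

(** The connection 1-form evaluated on w, as a matrix acting on row vectors from the right. *)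
Definition connection_mx x w : 'M[R]_n :=
  \matrix_(i, k) \sum_l w 0 l * christoffel G x k l i.

Lemma connection_formE x w u : connection_form G x w u = u *m connection_mx x w.
Proof.
apply/rowP => k; rewrite !mxE exchange_big; apply: eq_bigr => i _ /=.
by rewrite mxE mulr_sumr; apply: eq_bigr => l _; ring.
Qed.

Lemma connection_formDr x w u v :
  connection_form G x w (u + v) = connection_form G x w u + connection_form G x w v.
Proof. by rewrite !connection_formE mulmxDl. Qed.

Lemma connection_formZr x a w u :
  connection_form G x w (a *: u) = a *: connection_form G x w u.
Proof. by rewrite !connection_formE scalemxAl. Qed.

Lemma connection_form0r x w : connection_form G x w 0 = 0.
Proof. by rewrite connection_formE mul0mx. Qed.

Lemma connection_formC x w u : D x ->
  connection_form G x w u = connection_form G x u w.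
Proof.
move=> /christoffel_spec[Cs _]; apply/rowP => k; rewrite !mxE exchange_big.
by apply: eq_bigr => i _; apply: eq_bigr => j _ /=; rewrite Cs; ring.
Qed.

(** Compatibility of the connection with the metric, for fields along a map c from any normed space.
    It is used with c a curve, with c the identity (to differentiate the metric in its base point),
    and with c = [jet_pos] (to differentiate the Sasaki metric). *)
Lemma is_derive_metric_form (V : normedModType R) (c A B : V -> 'rV[R]_n) (y v : V)
    dA dB :
  D (c y) -> differentiable c y -> is_derive y v A dA -> is_derive y v B dB ->
  is_derive y v (fun z => metric_form (G (c z)) (A z) (B z))
    (metric_form (G (c y)) (dA + connection_form G (c y) ('D_v c y) (A y)) (B y) +
     metric_form (G (c y)) (A y) (dB + connection_form G (c y) ('D_v c y) (B y))).
Proof.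
move=> Dcy cy Ay By; set x := c y; set w := 'D_v c y; set C := connection_mx x w.
(* With C the connection matrix of the velocity of c, metric compatibility of the Christoffel
   symbols says that the derivative of G along c is C G + G C^T. *)
have gE i j : is_derive y v (fun z => G (c z) i j)
    ((C *m G x + G x *m C^T) i j).
  have gd := smooth_on_differentiable (sD i j) Dcy.
  apply: DeriveDef.
    by apply: diff_derivable; apply: (differentiable_comp cy gd).
  rewrite (@derive_comp_row _ _ _ _ (fun x => G x i j))// !mxE.
  under eq_bigr do rewrite (christoffel_spec Dcy).2 mulrDr !mulr_sumr.
  rewrite big_split /=; congr (_ + _); rewrite exchange_big; apply: eq_bigr => m _ /=.
    by rewrite !mxE mulr_suml; apply: eq_bigr => l _; rewrite mulrA.
  by rewrite !mxE mulr_sumr; apply: eq_bigr => l _; rewrite /x; ring.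
under eq_fun do rewrite metric_formE.
apply: is_derive_eq.
  apply: is_derive_bigsum => i; apply: is_derive_bigsum => j.
  exact: (is_deriveM (is_deriveM (is_derive_row i Ay) (gE i j)) (is_derive_row j By)).
rewrite !connection_formE -/x -/w -/C.
rewrite metric_formDl metric_formDr.
have -> : metric_form (G x) (A y *m C) (B y) = metric_form (C *m G x) (A y) (B y).
  by rewrite /metric_form !mulmxA.
have -> : metric_form (G x) (A y) (B y *m C) = metric_form (G x *m C^T) (A y) (B y).
  by rewrite /metric_form trmx_mul !mulmxA.
rewrite !metric_formE -!big_split; apply: eq_bigr => i _ /=.
rewrite -!big_split; apply: eq_bigr => j _ /=.
rewrite /GRing.scale/= !fctE -/x [(C *m G x + G x *m C^T) i j]mxE.
have rE (a a' b b' g p r : R) : a * g * b' + b * (a * (p + r) + g * a') =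
    a' * g * b + a * p * b + (a * g * b' + a * r * b) by ring.
exact: rE.
Qed.

End MetricOn.

(** * Covariant derivatives along a curve *)

Section CovariantDerivative.
Context {R : realType} {n : nat} (D : set 'rV[R]_n) (G : 'rV[R]_n -> 'M[R]_n).
Hypothesis GD : metric_on D G.
Implicit Types x u v w : 'rV[R]_n.

Let oD : open D. Proof. by case: GD. Qed.

(** The derivative of the Christoffel symbols at x in the direction w, contracted with u and v. *)
Definition christoffel_derive x w u v : 'rV[R]_n :=
  \row_k \sum_i \sum_j
    (\sum_l w 0 l * partial l (fun y => christoffel G y k i j) x) * u 0 i * v 0 j.

Lemma christoffel_derive0r x w u : christoffel_derive x w u 0 = 0.
Proof.
apply/rowP => k; rewrite mxE big1 ?mxE// => i _; rewrite big1// => j _.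
by rewrite [X in _ * X]mxE mulr0.
Qed.

Lemma is_derive_connection_form (V : normedModType R) (c A B : V -> 'rV[R]_n)
    (y v : V) dA dB :
  D (c y) -> differentiable c y -> is_derive y v A dA -> is_derive y v B dB ->
  is_derive y v (fun z => connection_form G (c z) (A z) (B z))
    (christoffel_derive (c y) ('D_v c y) (A y) (B y) +
     connection_form G (c y) dA (B y) + connection_form G (c y) (A y) dB).
Proof.
move=> Dcy cy Ay By.
have gE k i j : is_derive y v (fun z => christoffel G (c z) k i j)
    (\sum_l ('D_v c y) 0 l * partial l (fun x => christoffel G x k i j) (c y)).
  have gd := smooth_on_differentiable (smooth_on_christoffel GD k i j) Dcy.
  apply: DeriveDef.
    by apply: diff_derivable; apply: (differentiable_comp cy gd).
  exact: derive_comp_row gd.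
have kE k : is_derive y v (fun z => connection_form G (c z) (A z) (B z) 0 k)
    ((christoffel_derive (c y) ('D_v c y) (A y) (B y) +
      connection_form G (c y) dA (B y) + connection_form G (c y) (A y) dB) 0 k).
  under eq_fun do rewrite mxE.
  apply: is_derive_eq.
    apply: is_derive_bigsum => i; apply: is_derive_bigsum => j.
    exact: (is_deriveM (is_deriveM (gE k i j) (is_derive_row i Ay)) (is_derive_row j By)).
  rewrite !mxE -!big_split; apply: eq_bigr => i _ /=.
  rewrite -!big_split; apply: eq_bigr => j _ /=.
  rewrite /GRing.scale/= !fctE.
  have rE (a a' b b' g g' : R) : g * a * b' + b * (g * a' + a * g') =
      g' * a * b + g * a' * b + g * a * b' by ring.
  exact: rE.
have cd : derivable (fun z => connection_form G (c z) (A z) (B z)) y v.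
  by apply/derivable_mxP => i k; rewrite ord1; case: (kE k).
apply: DeriveDef => //; rewrite derive_mx//; apply/matrixP => i k.
by rewrite ord1 mxE; case: (kE k).
Qed.

Lemma smooth_on_connection_form (V : normedModType R) (U : set V)
    (c A B : V -> 'rV[R]_n) :
  smooth_on U c -> {homo c : x / U x >-> D x} -> smooth_on U A ->
  smooth_on U B -> smooth_on U (fun z => connection_form G (c z) (A z) (B z)).
Proof.
move=> cU cUD AU BU; have oU := cU.1.
apply: smooth_on_row => // k; under eq_fun do rewrite mxE.
apply: smooth_on_sum => // i; apply: smooth_on_sum => // j.
apply: smooth_onM; last exact: smooth_on_row_coord.
apply: smooth_onM; last exact: smooth_on_row_coord.
exact: smooth_on_comp cU cUD (smooth_on_christoffel GD k i j).
Qed.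

Lemma smooth_on_christoffel_derive (V : normedModType R) (U : set V)
    (c C A B : V -> 'rV[R]_n) :
  smooth_on U c -> {homo c : x / U x >-> D x} -> smooth_on U C ->
  smooth_on U A -> smooth_on U B ->
  smooth_on U (fun z => christoffel_derive (c z) (C z) (A z) (B z)).
Proof.
move=> cU cUD CU AU BU; have oU := cU.1.
apply: smooth_on_row => // k; under eq_fun do rewrite mxE.
apply: smooth_on_sum => // i; apply: smooth_on_sum => // j.
apply: smooth_onM; last exact: smooth_on_row_coord.
apply: smooth_onM; last exact: smooth_on_row_coord.
apply: smooth_on_sum => // l; apply: smooth_onM; first exact: smooth_on_row_coord.
apply: smooth_on_comp cU cUD _; apply: smooth_on_derive.
exact: smooth_on_christoffel GD k i j.
Qed.

Lemma smooth_on_cov_derive (U : set R) (c V : R -> 'rV[R]_n) :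
  smooth_on U c -> {homo c : x / U x >-> D x} -> smooth_on U V ->
  smooth_on U (cov_derive G c V).
Proof.
move=> cU cUD VU; apply: smooth_onD; first exact: smooth_on_derive1.
by apply: smooth_on_connection_form => //; exact: smooth_on_derive1.
Qed.

Lemma smooth_on_is_derive1 (W : normedModType R) (U : set R) (f : R -> W) t :
  smooth_on U f -> U t -> is_derive t (1 : R) f (derive1 f t).
Proof.
by move=> fU Ut; rewrite derive1E; apply: derivableP; exact: smooth_on_derivable fU Ut.
Qed.

(** The right-hand side depends only on the 2-jets of c and V at t. It therefore evaluates [K2] on
    any adapted family, and also identifies [K2] along a jet curve with a second covariant
    derivative. *)
Lemma cov_derive2E (U : set R) (c V : R -> 'rV[R]_n) t :
  smooth_on U c -> {homo c : x / U x >-> D x} -> smooth_on U V -> U t ->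
  cov_derive G c (cov_derive G c V) t =
  derive1n 2 V t +
  (christoffel_derive (c t) (derive1 c t) (derive1 c t) (V t) +
   connection_form G (c t) (derive1n 2 c t) (V t) +
   connection_form G (c t) (derive1 c t) (derive1 V t)) +
  connection_form G (c t) (derive1 c t)
    (derive1 V t + connection_form G (c t) (derive1 c t) (V t)).
Proof.
move=> cU cUD VU Ut.
have dc := smooth_on_is_derive1 (smooth_on_derive1 cU) Ut.
have dV := smooth_on_is_derive1 (smooth_on_derive1 VU) Ut.
have h := is_derive_connection_form (cUD _ Ut)
  (smooth_on_differentiable cU Ut) dc (smooth_on_is_derive1 VU Ut).
rewrite {1}/cov_derive; congr (_ + _).
rewrite derive1E derive1nS -derive1E in h *.
by have := is_deriveD dV h => /(@derive_val _ _ _ _ _ _ _) <-; rewrite derive1E.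
Qed.

Lemma derive1_metric_form (U : set R) (c A B : R -> 'rV[R]_n) t :
  smooth_on U c -> {homo c : x / U x >-> D x} ->
  smooth_on U A -> smooth_on U B -> U t ->
  derive1 (fun s => metric_form (G (c s)) (A s) (B s)) t =
  metric_form (G (c t)) (cov_derive G c A t) (B t) +
  metric_form (G (c t)) (A t) (cov_derive G c B t).
Proof.
move=> cU cUD AU BU Ut.
have h := is_derive_metric_form GD (cUD _ Ut) (smooth_on_differentiable cU Ut)
  (smooth_on_is_derive1 AU Ut) (smooth_on_is_derive1 BU Ut).
by rewrite derive1E (@derive_val _ _ _ _ _ _ _ h) /cov_derive !derive1E.
Qed.

(** For a constant coordinate vector Z, differentiating g(c', Z) along c produces the extra term
    g(c', Γ(c', Z)), and half the derivative of the kinetic form in the direction Z is g(c', Γ(Z,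
    c')); symmetry of Γ cancels them. Geodesics of the Sasaki metric can thus be studied without
    computing its Christoffel symbols. *)
Lemma euler_lagrange (U : set R) (c : R -> 'rV[R]_n) t Z :
  smooth_on U c -> {homo c : x / U x >-> D x} -> U t ->
  metric_form (G (c t)) (cov_derive G c (derive1 c) t) Z =
  derive1 (fun s => metric_form (G (c s)) (derive1 c s) Z) t -
  2^-1 * 'D_Z (fun y => metric_form (G y) (derive1 c t) (derive1 c t)) (c t).
Proof.
move=> cU cUD Ut; have Dct := cUD _ Ut; have oU := cU.1.
have Gs : (G (c t))^T = G (c t) by case: GD => _ _ + _; exact.
rewrite (derive1_metric_form cU cUD (smooth_on_derive1 cU) (smooth_onC Z oU) Ut).
set u := derive1 c t.
have did : differentiable (id : 'rV[R]_n -> 'rV[R]_n) (c t) by exact: ex_diff.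
(* The velocity u is frozen: metric compatibility is applied over the identity map to the constant
   field u. *)
have h : is_derive (c t) Z _ _ :=
  @is_derive_metric_form _ _ _ _ GD _ id (cst u) (cst u) _ Z 0 0 Dct did
    (is_derive_cst u (c t) Z) (is_derive_cst u (c t) Z).
rewrite (@derive_val _ _ _ _ _ _ _ h) /= derive_id !add0r.
rewrite /cov_derive derive1_cst add0r (connection_formC GD _ _ Dct).
rewrite [X in _ * (X + _)](metric_formC _ _ Gs).
set a := metric_form _ u _; lra.
Qed.

Lemma geodesic_euler_lagrange (U : set R) (c : R -> 'rV[R]_n) t Z :
  smooth_on U c -> {homo c : x / U x >-> D x} -> U t ->
  cov_derive G c (derive1 c) t = 0 ->
  derive1 (fun s => metric_form (G (c s)) (derive1 c s) Z) t =
  2^-1 * 'D_Z (fun y => metric_form (G y) (derive1 c t) (derive1 c t)) (c t).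
Proof.
move=> cU cUD Ut ct0; have := euler_lagrange Z cU cUD Ut.
by rewrite ct0 metric_form0l => /esym/eqP; rewrite subr_eq0 => /eqP.
Qed.

Lemma cov_derive_near (c c' V V' : R -> 'rV[R]_n) t :
  (\near t, c t = c' t) -> (\near t, V t = V' t) ->
  cov_derive G c V t = cov_derive G c' V' t.
Proof.
move=> cc VV; rewrite /cov_derive !derive1E (near_eq_derive _ cc).
by rewrite (near_eq_derive _ VV) (nbhs_singleton cc) (nbhs_singleton VV).
Qed.

(** Locality of the geodesic equation; it allows the jet lift read in a chart to be replaced by its
    explicit coordinate expression. *)
Lemma cov_derive_velocity_eq (U : set R) (c c' : R -> 'rV[R]_n) t :
  open U -> {in U, c =1 c'} -> U t ->
  cov_derive G c (derive1 c) t = cov_derive G c' (derive1 c') t.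
Proof.
move=> oU cc Ut.
have nE s : U s -> \near s, c s = c' s.
  move=> Us; apply: filterS (open_nbhs_nbhs (conj oU Us)) => r Ur.
  by apply: cc; rewrite inE.
apply: cov_derive_near; first exact: nE.
apply: filterS (open_nbhs_nbhs (conj oU Ut)) => s Us.
by rewrite !derive1E; exact/near_eq_derive/nE.
Qed.

End CovariantDerivative.

(** * The Sasaki metric in an induced chart *)

Section AdaptedFamily.
Context {R : realType} {n : nat}.
Implicit Types u X : 'rV[R]_(n + n + n).

Lemma jet_posDZ a u X : jet_pos (a *: u + X) = a *: jet_pos u + jet_pos X.
Proof. by rewrite /jet_pos !linearP. Qed.

Lemma jet_velDZ a u X : jet_vel (a *: u + X) = a *: jet_vel u + jet_vel X.
Proof. by rewrite /jet_vel !linearP. Qed.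

Lemma jet_accDZ a u X : jet_acc (a *: u + X) = a *: jet_acc u + jet_acc X.
Proof. by rewrite /jet_acc !linearP. Qed.

Lemma smooth_on_adapted_family u X (s : R) : smooth_on setT (adapted_family u X s).
Proof.
have idR : smooth_on [set: R] (fun t : R => t).
  by apply: (@smooth_on_linear _ _ _ (idfun : {linear R -> R})) => x; exact: cvg_id.
apply: smooth_on_row => [|j]; first exact: openT.
have sC (a : R) : smooth_on [set: R] (fun=> a) by exact: smooth_onC openT.
pose w := u + s *: X.
have : smooth_on [set: R] (fun t => jet_pos w 0 j + t * jet_vel w 0 j +
    (2^-1 * (t * t)) * jet_acc w 0 j).
  by do ?[apply: smooth_onD|apply: smooth_onM].
apply: smooth_on_eq => t _.
by rewrite /adapted_family -/w; move: w => w; rewrite !mxE expr2.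
Qed.

(** The adapted family is affine in s, and its slope is the quadratic curve with 2-jet X, which
    [adapted_family X 0 0] denotes. *)
Lemma variation_fieldE u X : variation_field u X = adapted_family X 0 0.
Proof.
apply/funext => t; rewrite /variation_field.
have -> : (fun s => adapted_family u X s t) =
    fun s => adapted_family u 0 0 t + s *: adapted_family X 0 0 t.
  apply/funext => s; rewrite /adapted_family !scaler0 !addr0.
  rewrite [u + _]addrC jet_posDZ jet_velDZ jet_accDZ.
  apply/rowP => j; rewrite !mxE; ring.
set a := adapted_family u _ _ _; set b := adapted_family X _ _ _.
have h : is_derive (0 : R) (1 : R) (fun s : R => s *: b) b.
  have sd : differentiable (fun s : R => s *: b) (0 : R).
    exact: (differentiableZl b (@ex_diff _ _ _ _ _ id id _)).
  apply: DeriveDef; first exact: diff_derivable.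
  rewrite deriveE// (@diffZl _ _ _ id)//=.
  by rewrite -deriveE// derive_id scale1r.
have ha : is_derive (0 : R) (1 : R) (cst a : R -> 'rV[R]_n) 0 by exact: is_derive_cst.
have := is_deriveD ha h.
by rewrite derive1E => /(@derive_val _ _ _ _ _ _ _) ->; rewrite add0r.
Qed.

Lemma adapted_family_jet u :
  [/\ adapted_family u 0 0 0 = jet_pos u,
      derive1 (adapted_family u 0 0) 0 = jet_vel u &
      derive1n 2 (adapted_family u 0 0) 0 = jet_acc u].
Proof.
have := adapted_familyP u 0 0; rewrite scale0r addr0 /jet_coord.
move: (adapted_family u 0 0) => c uE.
by rewrite -uE /jet_pos /jet_vel /jet_acc !(row_mxKl, row_mxKr).
Qed.

Lemma adapted_family0 u X : adapted_family u X 0 = adapted_family u 0 0.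
Proof. by apply/funext => t; rewrite /adapted_family !scale0r. Qed.

Lemma smooth_on_jet_pos (U : set 'rV[R]_(n + n + n)) :
  open U -> smooth_on U (@jet_pos R n).
Proof.
move=> oU; apply: smooth_on_row => // j.
by under eq_fun do rewrite !mxE; exact: smooth_on_coord.
Qed.

Lemma smooth_on_jet_vel (U : set 'rV[R]_(n + n + n)) :
  open U -> smooth_on U (@jet_vel R n).
Proof.
move=> oU; apply: smooth_on_row => // j.
by under eq_fun do rewrite !mxE; exact: smooth_on_coord.
Qed.

Lemma smooth_on_jet_acc (U : set 'rV[R]_(n + n + n)) :
  open U -> smooth_on U (@jet_acc R n).
Proof.
move=> oU; apply: smooth_on_row => // j.
by under eq_fun do rewrite !mxE; exact: smooth_on_coord.
Qed.

End AdaptedFamily.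

(** * Connection maps in coordinates, smoothness and positivity of the Sasaki metric *)

Section SasakiMetric.
Context {R : realType} {n : nat} (D : set 'rV[R]_n) (G : 'rV[R]_n -> 'M[R]_n).
Hypothesis GD : metric_on D G.
Implicit Types u X Z : 'rV[R]_(n + n + n).

Let oD : open D. Proof. by case: GD. Qed.

Definition jet_dom : set 'rV[R]_(n + n + n) := @jet_pos R n @^-1` D.

Lemma K1E u X :
  K1 G u X = jet_vel X + connection_form G (jet_pos u) (jet_vel u) (jet_pos X).
Proof.
rewrite /K1 /cov_derive variation_fieldE adapted_family0.
by have [-> -> _] := adapted_family_jet u; have [-> -> _] := adapted_family_jet X.
Qed.

Lemma open_jet_dom : open jet_dom.
Proof.
apply: open_comp oD => u _.
apply: differentiable_continuous.
exact: (smooth_on_differentiable (smooth_on_jet_pos openT)).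
Qed.

Lemma K2E u X : jet_dom u ->
  K2 G u X = 2^-1 *: (jet_acc X +
    (christoffel_derive G (jet_pos u) (jet_vel u) (jet_vel u) (jet_pos X) +
     connection_form G (jet_pos u) (jet_acc u) (jet_pos X) +
     connection_form G (jet_pos u) (jet_vel u) (jet_vel X)) +
    connection_form G (jet_pos u) (jet_vel u) (K1 G u X)).
Proof.
move=> Du; rewrite K1E /K2 variation_fieldE adapted_family0; congr (_ *: _).
have [c0 c1 c2] := adapted_family_jet u; have [X0 X1 X2] := adapted_family_jet X.
set c := adapted_family u 0 0 in c0 c1 c2 *.
have sc : smooth_on setT c by exact: smooth_on_adapted_family.
(* The quadratic curve c starts in D but may leave it, so the calculus is restricted to the open set
   of times spent in D. *)
have oU : open (c @^-1` D).
  apply: open_comp oD => t _; apply: differentiable_continuous.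
  exact: (smooth_on_differentiable sc).
rewrite (@cov_derive2E _ _ _ _ GD (c @^-1` D)).
- by rewrite c0 c1 c2 X0 X1 X2.
- exact: smooth_on_subset sc.
- by [].
- exact: smooth_on_subset (smooth_on_adapted_family _ _ _).
- by rewrite /= c0.
Qed.

Lemma linear_K1 u : linear (K1 G u).
Proof.
move=> a X Y; rewrite !K1E jet_velDZ jet_posDZ.
by rewrite connection_formDr connection_formZr scalerDr addrACA.
Qed.

Lemma linear_K2 u : jet_dom u -> linear (K2 G u).
Proof.
move=> Du a X Y; rewrite !K2E// linear_K1 jet_velDZ jet_posDZ jet_accDZ.
have dE v w w' : christoffel_derive G (jet_pos u) v v (a *: w + w') =
    a *: christoffel_derive G (jet_pos u) v v w + christoffel_derive G (jet_pos u) v v w'.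
  apply/rowP => k; rewrite !mxE mulr_sumr -big_split; apply: eq_bigr => i _ /=.
  rewrite mulr_sumr -big_split; apply: eq_bigr => j _ /=.
  by rewrite !mxE; ring.
rewrite (dE (jet_vel u) (jet_pos X) (jet_pos Y)).
rewrite (connection_formDr _ _ _ (a *: jet_pos X)).
rewrite (connection_formDr _ _ _ (a *: jet_vel X)).
rewrite (connection_formDr _ _ _ (a *: K1 G u X)).
rewrite !connection_formZr.
have aux (A A' B B' C C' E E' F F' : 'rV[R]_n) :
    2^-1 *: (a *: A + A' + (a *: B + B' + (a *: C + C') + (a *: E + E')) +
      (a *: F + F')) =
    a *: (2^-1 *: (A + (B + C + E) + F)) + 2^-1 *: (A' + (B' + C' + E') + F').
  by apply/rowP => k; rewrite !mxE; ring.
exact: aux.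
Qed.

Lemma smooth_on_K1 X : smooth_on jet_dom (fun u => K1 G u X).
Proof.
under eq_fun do rewrite K1E; have oU := open_jet_dom.
apply: smooth_onD; first exact: smooth_onC.
apply: (smooth_on_connection_form GD) => //; last exact: smooth_onC.
  exact: smooth_on_jet_pos.
exact: smooth_on_jet_vel.
Qed.

Lemma smooth_on_K2 X : smooth_on jet_dom (fun u => K2 G u X).
Proof.
have oU := open_jet_dom.
have sp := smooth_on_jet_pos oU; have sv := smooth_on_jet_vel oU.
have sa := smooth_on_jet_acc oU.
have sC (a : 'rV[R]_n) : smooth_on jet_dom (fun=> a) by exact: smooth_onC.
have sZ (f : 'rV[R]_(n + n + n) -> 'rV[R]_n) :
    smooth_on jet_dom f -> smooth_on jet_dom (fun u => 2^-1 *: f u).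
  move=> fU; apply: smooth_on_row => // j; under eq_fun do rewrite mxE.
  by apply: smooth_onM; [exact: smooth_onC|exact: smooth_on_row_coord].
apply: smooth_on_eq; first by move=> u /set_mem Du; exact/esym/(K2E X Du).
apply: sZ; apply: smooth_onD; last first.
  by apply: (smooth_on_connection_form GD) => //; exact: smooth_on_K1.
apply: smooth_onD => //; apply: smooth_onD.
  apply: smooth_onD; last exact: (smooth_on_connection_form GD).
  exact: (smooth_on_christoffel_derive GD).
exact: (smooth_on_connection_form GD).
Qed.

Lemma metric_form_linear m (A : 'M[R]_n) (T : 'rV[R]_m -> 'rV[R]_n) (X Z : 'rV[R]_m) :
  linear T ->
  metric_form A (T X) (T Z) =
  \sum_a \sum_b X 0 a * metric_form A (T (delta_mx 0 a)) (T (delta_mx 0 b)) * Z 0 b.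
Proof.
move=> lT.
have TE (Y : 'rV[R]_m) : T Y = \sum_a Y 0 a *: T (delta_mx 0 a).
  have T0 : T 0 = 0.
    by have := lT (-1) 0 0; rewrite scaler0 addr0 scaleN1r addNr.
  rewrite [in LHS](row_sum_delta Y).
  by elim/big_rec2 : _ => [|i y1 y2 _ <-]; rewrite ?T0// lT.
rewrite [T X]TE [T Z]TE metric_form_suml; apply: eq_bigr => a _.
rewrite metric_form_sumr; apply: eq_bigr => b _.
by rewrite metric_formZl metric_formZr; ring.
Qed.

(** The matrix samples the form on basis vectors; linearity of the projection, of [K1] and of [K2]
    in the tangent vector recovers the form everywhere. *)
Lemma sasaki_coefE u X Z : jet_dom u ->
  metric_form (sasaki_coef G u) X Z = sasaki_form G u X Z.
Proof.
move=> Du; rewrite metric_formE /sasaki_form /T2_proj_tangent.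
rewrite (@metric_form_linear _ _ (@jet_pos R n)); last by move=> *; exact: jet_posDZ.
rewrite (metric_form_linear _ _ _ (@linear_K1 u)).
rewrite (metric_form_linear _ _ _ (linear_K2 Du)).
rewrite -!big_split; apply: eq_bigr => a _ /=.
rewrite -!big_split; apply: eq_bigr => b _ /=.
by rewrite mxE /sasaki_form !mulrDr !mulrDl.
Qed.

Lemma jet_eq0 X : jet_pos X = 0 -> jet_vel X = 0 -> jet_acc X = 0 -> X = 0.
Proof.
rewrite /jet_pos /jet_vel /jet_acc => p v a.
by rewrite -[X]hsubmxK -[lsubmx X]hsubmxK p v a !row_mx0.
Qed.

Lemma smooth_on_metric_form (V : normedModType R) (U : set V) (c A B : V -> 'rV[R]_n) :
  smooth_on U c -> {homo c : x / U x >-> D x} -> smooth_on U A -> smooth_on U B ->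
  smooth_on U (fun y => metric_form (G (c y)) (A y) (B y)).
Proof.
move=> cU cUD AU BU; have oU := cU.1; under eq_fun do rewrite metric_formE.
apply: smooth_on_sum => // i; apply: smooth_on_sum => // j.
apply: smooth_onM; last exact: smooth_on_row_coord.
apply: smooth_onM; first exact: smooth_on_row_coord.
by case: GD => _ sG _ _; exact: smooth_on_comp cU cUD (sG i j).
Qed.

Lemma sasaki_formC u X Z : (G (jet_pos u))^T = G (jet_pos u) ->
  sasaki_form G u X Z = sasaki_form G u Z X.
Proof.
move=> Gs; exact: (f_equal2 +%R (f_equal2 +%R
  (metric_formC (T2_proj_tangent X) (T2_proj_tangent Z) Gs)
  (metric_formC (K1 G u X) (K1 G u Z) Gs))
  (metric_formC (K2 G u X) (K2 G u Z) Gs)).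
Qed.

(** Positivity comes from a triangular structure: the form is a sum of three squares, and if all
    vanish then X has zero position part, whence [K1] reduces to its velocity part and then [K2] to
    half its acceleration part. *)
Lemma sasaki_metric_on : metric_on jet_dom (sasaki_coef G).
Proof.
have oU := open_jet_dom; have sp := smooth_on_jet_pos oU.
have symG u : jet_dom u -> (G (jet_pos u))^T = G (jet_pos u).
  by move=> Du; case: GD => _ _ + _; exact.
split=> //.
- move=> a b; under eq_fun do rewrite mxE.
  apply: smooth_onD; last by apply: smooth_on_metric_form => //; exact: smooth_on_K2.
  apply: smooth_onD; last by apply: smooth_on_metric_form => //; exact: smooth_on_K1.
  by apply: smooth_on_metric_form => //; exact: smooth_onC.
- move=> u Du; have sE a b : sasaki_coef G u a b =
      sasaki_form G u (delta_mx 0 a) (delta_mx 0 b) by rewrite mxE.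
  apply/matrixP => a b; rewrite mxE !sE.
  exact/sasaki_formC/symG.
- move=> u Du X X0; rewrite sasaki_coefE// /sasaki_form /T2_proj_tangent.
  have ge0 v := metric_ge0 GD v Du.
  rewrite lt0r !addr_ge0// andbT.
  apply: contra_neq X0 => /eqP.
  rewrite paddr_eq0 ?addr_ge0// paddr_eq0// => /andP[/andP[/eqP p0 /eqP v0] /eqP a0].
  have {}p0 := metric_eq0 GD Du p0; have {}v0 := metric_eq0 GD Du v0.
  have {}a0 := metric_eq0 GD Du a0.
  have xv0 : jet_vel X = 0 by move: v0; rewrite K1E p0 connection_form0r addr0.
  apply: jet_eq0 => //; move: a0.
  rewrite K2E// v0 xv0 p0 !connection_form0r christoffel_derive0r !addr0.
  by move=> /eqP; rewrite scaler_eq0 invr_eq0 pnatr_eq0 /= => /eqP.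
Qed.

End SasakiMetric.

(** * Jet curves in a chart *)

Section JetCurve.
Context {R : realType} {n : nat} (D : set 'rV[R]_n) (G : 'rV[R]_n -> 'M[R]_n).
Hypothesis GD : metric_on D G.
Variables (U : set R) (x : R -> 'rV[R]_n).
Hypotheses (xU : smooth_on U x) (xUD : {homo x : t / U t >-> D t}).

Let oU : open U := xU.1.
Let sx1 : smooth_on U (derive1 x) := smooth_on_derive1 xU.
Let sx2 : smooth_on U (derive1n 2 x) := smooth_on_derive1 sx1.

Definition jet_curve (t : R) : 'rV[R]_(n + n + n) :=
  row_mx (row_mx (x t) (derive1 x t)) (derive1n 2 x t).

Lemma jet_curveE t :
  [/\ jet_pos (jet_curve t) = x t, jet_vel (jet_curve t) = derive1 x t &
      jet_acc (jet_curve t) = derive1n 2 x t].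
Proof. by rewrite /jet_pos /jet_vel /jet_acc !(row_mxKl, row_mxKr). Qed.

Lemma jet_curve_dom : {homo jet_curve : t / U t >-> jet_dom D t}.
Proof. by move=> t /xUD; rewrite /jet_dom /=; have [-> _ _] := jet_curveE t. Qed.

Lemma smooth_on_jet_curve : smooth_on U jet_curve.
Proof.
have srow p q (f : R -> 'rV[R]_p) (g : R -> 'rV[R]_q) : smooth_on U f ->
    smooth_on U g -> smooth_on U (fun t => row_mx (f t) (g t)).
  move=> fU gU; apply: smooth_on_row => // j; rewrite -(fintype.splitK j).
  case: (fintype.split j) => k; rewrite /=.
    under eq_fun do rewrite row_mxEl.
    exact: smooth_on_row_coord.
  under eq_fun do rewrite row_mxEr.
  exact: smooth_on_row_coord.
by apply: (srow _ _ _ _ (srow _ _ _ _ xU sx1) sx2).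
Qed.

Let sw := smooth_on_jet_curve.

Lemma derive1_jet_curveE t : U t ->
  [/\ jet_pos (derive1 jet_curve t) = derive1 x t,
      jet_vel (derive1 jet_curve t) = derive1n 2 x t &
      jet_acc (derive1 jet_curve t) = derive1n 3 x t].
Proof.
move=> Ut.
have dw j : (derive1 jet_curve t) 0 j = derive1 (fun s => jet_curve s 0 j) t.
  by rewrite !derive1E derive_row//; exact: smooth_on_derivable sw Ut.
have dx (f : R -> 'rV[R]_n) j : smooth_on U f ->
    (derive1 f t) 0 j = derive1 (fun s => f s 0 j) t.
  by move=> fU; rewrite !derive1E derive_row//; exact: smooth_on_derivable fU Ut.
split; apply/rowP => j; rewrite !mxE dw.
- rewrite dx//; congr (derive1 _ _); apply/funext => s.
  by have [<- _ _] := jet_curveE s; rewrite !mxE.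
- rewrite derive1nS derive1n1 dx//; congr (derive1 _ _); apply/funext => s.
  by have [_ <- _] := jet_curveE s; rewrite !mxE.
- rewrite derive1nS dx//; congr (derive1 _ _); apply/funext => s.
  by have [_ _ <-] := jet_curveE s; rewrite !mxE.
Qed.

Let J := cov_derive G x (derive1 x).
Let J1 := cov_derive G x J.
Let J2 := cov_derive G x J1.
Let g t := metric_form (G (x t)).

Let sJ : smooth_on U J. Proof. exact: (smooth_on_cov_derive GD xU xUD sx1). Qed.
Let sJ1 : smooth_on U J1. Proof. exact: (smooth_on_cov_derive GD xU xUD sJ). Qed.

Lemma K1_jet_curve t : U t -> K1 G (jet_curve t) (derive1 jet_curve t) = J t.
Proof.
move=> Ut; rewrite K1E; have [-> -> _] := jet_curveE t.
by have [-> -> _] := derive1_jet_curveE Ut.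
Qed.

(** The coordinate formula [K2E] at w and w' is, term by term, half of [cov_derive2E] for the field
    x' along x. *)
Lemma K2_jet_curve t : U t ->
  K2 G (jet_curve t) (derive1 jet_curve t) = 2^-1 *: J1 t.
Proof.
move=> Ut; rewrite (K2E GD); last exact: jet_curve_dom.
rewrite K1_jet_curve//; have [-> -> ->] := jet_curveE t.
have [-> -> ->] := derive1_jet_curveE Ut.
by rewrite /J1 /J (cov_derive2E GD xU xUD sx1 Ut).
Qed.

Let S := sasaki_coef G.
Let w := jet_curve.
Let SD : metric_on (jet_dom D) S := sasaki_metric_on GD.

Lemma sasaki_jet_curve t Z : U t ->
  metric_form (S (w t)) (derive1 w t) Z =
  g t (derive1 x t) (jet_pos Z) + g t (J t) (K1 G (w t) Z) +
  g t (2^-1 *: J1 t) (K2 G (w t) Z).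
Proof.
move=> Ut; rewrite (sasaki_coefE GD); last exact: jet_curve_dom.
rewrite /sasaki_form /T2_proj_tangent (K1_jet_curve Ut) (K2_jet_curve Ut).
by rewrite /w /g; have [-> _ _] := jet_curveE t; have [-> _ _] := derive1_jet_curveE Ut.
Qed.

(** The tangent vector X is frozen while the base jet moves in the direction Z. Each of the three
    summands is then the square norm of a field along [jet_pos], and metric compatibility applies to
    it. *)
Lemma derive_sasaki t (Z X : 'rV[R]_(n + n + n)) : U t ->
  'D_Z (fun y => metric_form (S y) X X) (w t) =
  2 * g t (jet_pos X) (connection_form G (x t) (jet_pos Z) (jet_pos X)) +
  2 * g t (K1 G (w t) X) ('D_Z (fun y => K1 G y X) (w t) +
        connection_form G (x t) (jet_pos Z) (K1 G (w t) X)) +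
  2 * g t (K2 G (w t) X) ('D_Z (fun y => K2 G y X) (w t) +
        connection_form G (x t) (jet_pos Z) (K2 G (w t) X)).
Proof.
move=> Ut; have Dw := jet_curve_dom Ut; have oJ := open_jet_dom GD.
have -> : 'D_Z (fun y => metric_form (S y) X X) (w t) =
    'D_Z (fun y => sasaki_form G y X X) (w t).
  apply: near_eq_derive; apply: filterS (open_nbhs_nbhs (conj oJ Dw)) => y.
  exact: (sasaki_coefE GD).
have sp := smooth_on_jet_pos (@openT 'rV[R]_(n + n + n)).
have dp : differentiable (@jet_pos R n) (w t) by exact: smooth_on_differentiable sp _.
have Dp : 'D_Z (@jet_pos R n) (w t) = jet_pos Z.
  apply/rowP => j; rewrite derive_row; last exact: diff_derivable.
  rewrite !mxE; under eq_fun do rewrite !mxE.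
  by rewrite -(derive_row _ (@derivable_id _ _ _ _)) derive_id.
have Gs : (G (x t))^T = G (x t) by case: GD => _ _ + _; apply; exact: xUD.
have half (A : 'rV[R]_(n + n + n) -> 'rV[R]_n) : derivable A (w t) Z ->
    is_derive (w t) Z (fun y => metric_form (G (jet_pos y)) (A y) (A y))
      (2 * g t (A (w t)) ('D_Z A (w t) +
             connection_form G (x t) (jet_pos Z) (A (w t)))).
  move=> /derivableP HA; have := is_derive_metric_form GD Dw dp HA HA.
  rewrite Dp /w; have [-> _ _] := jet_curveE t => H.
  apply: is_derive_eq H _; rewrite -/w /g.
  by rewrite [X in X + _ = _](metric_formC _ _ Gs) -mulr2n mulr_natl.
have H0 := half _ (@derivable_cst _ _ _ (jet_pos X) (w t) Z).
have H1 := half _ (smooth_on_derivable (v := Z) (smooth_on_K1 GD X) Dw).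
have H2 := half _ (smooth_on_derivable (v := Z) (smooth_on_K2 GD X) Dw).
have H := is_deriveD (is_deriveD H0 H1) H2.
apply: etrans (@derive_val _ _ _ _ _ _ _ H) _.
by rewrite derive_cst add0r.
Qed.

Let dg (A B : R -> 'rV[R]_n) t : smooth_on U A -> smooth_on U B -> U t ->
  is_derive t (1 : R) (fun s => g s (A s) (B s))
    (g t (cov_derive G x A t) (B t) + g t (A t) (cov_derive G x B t)).
Proof.
move=> AU BU Ut; rewrite -(derive1_metric_form GD xU xUD AU BU Ut).
have sG : smooth_on U (fun s => g s (A s) (B s))
  by exact: (smooth_on_metric_form GD xU xUD AU BU).
exact: smooth_on_is_derive1 sG Ut.
Qed.

Let derive_eq0 (f : R -> R) t df : {in U, forall s, f s = 0} -> U t ->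
  is_derive t (1 : R) f df -> df = 0.
Proof.
move=> f0 Ut fd; rewrite -(@derive_val _ _ _ _ _ _ _ fd).
rewrite (@near_eq_derive _ _ _ _ (cst 0)) ?derive_cst//.
by apply: filterS (open_nbhs_nbhs (conj oU Ut)) => s Us; apply: f0; rewrite inE.
Qed.

Let gC t A B : U t -> g t A B = g t B A.
Proof. by move=> Ut; apply: metric_formC; case: GD => _ _ + _; apply; exact: xUD. Qed.

(** * A geodesic jet curve projects to a geodesic *)

Section Forward.
Hypothesis w_geod : {in U, forall t, cov_derive S w (derive1 w) t = 0}.

(** Against a vertical direction (0, 0, z) both sides of the Euler-Lagrange equation contain g(J1,
    Γ(x', z)) / 4; after cancellation g(J2, z) = 0 remains. *)
Lemma cov_derive3_eq0 t : U t -> J2 t = 0.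
Proof.
(* One of the two copies of [J2 t] becomes an arbitrary test vector z, held constant in coordinates
   when differentiating. *)
move=> Ut; apply: (metric_eq0 GD (xUD Ut)); move: {2}(J2 t) => z.
pose Z : 'rV[R]_(n + n + n) := row_mx (0 : 'rV[R]_(n + n)) z.
have Zp : jet_pos Z = 0 by rewrite /jet_pos row_mxKl linear0.
have Zv : jet_vel Z = 0 by rewrite /jet_vel row_mxKl linear0.
have Za : jet_acc Z = z by rewrite /jet_acc row_mxKr.
have conn0l s v : U s -> connection_form G (x s) 0 v = 0.
  by move=> Us; rewrite (connection_formC GD _ _ (xUD Us)) connection_form0r.
have K1Z u : K1 G u Z = 0 by rewrite K1E Zv Zp connection_form0r addr0.
have K2Z s : U s -> K2 G (w s) Z = 2^-1 *: z.
  move=> Us; rewrite (K2E GD); last exact: jet_curve_dom.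
  by rewrite K1Z Zp Zv Za !connection_form0r christoffel_derive0r !addr0.
have := geodesic_euler_lagrange SD Z sw jet_curve_dom Ut (w_geod (mem_set Ut)).
(* The momentum in the direction Z is g(J1 / 2, z / 2), one factor 1/2 coming from each value of
   [K2]; hence 1/4. *)
have Fd : derive1 (fun s => metric_form (S (w s)) (derive1 w s) Z) t =
    4^-1 * (g t (J2 t) z + g t (J1 t) (connection_form G (x t) (derive1 x t) z)).
  rewrite derive1E.
  rewrite (@near_eq_derive _ _ _ _ (fun s => g s (J1 s) (4^-1 *: z))); last first.
    apply: filterS (open_nbhs_nbhs (conj oU Ut)) => s Us.
    rewrite (sasaki_jet_curve _ Us) Zp K1Z (K2Z s Us) /g !metric_form0r !add0r.
    by rewrite metric_formZl !metric_formZr mulrA -invfM -natrM.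
  rewrite (@derive_val _ _ _ _ _ _ _ (dg sJ1 (smooth_onC (4^-1 *: z) oU) Ut)).
  have -> : cov_derive G x (fun=> 4^-1 *: z) t =
      4^-1 *: connection_form G (x t) (derive1 x t) z.
    by rewrite -connection_formZr -[RHS]add0r -(derive1_cst (4^-1 *: z) t).
  by rewrite /g !metric_formZr mulrDr.
rewrite Fd (derive_sasaki _ _ Ut) Zp !(conn0l t _ Ut) !addr0.
rewrite {2 3}/g metric_form0r mulr0 add0r.
set X := derive1 w t; have Dw := jet_curve_dom Ut.
have [wp wv wa] := jet_curveE t; have [Xp _ _] := derive1_jet_curveE Ut.
(* [K1] depends only on the position and velocity of the base jet, which Z leaves unchanged. *)
have DK1 : 'D_Z (fun y => K1 G y X) (w t) = 0.
  apply: derive_line => h; rewrite scaler0 addr0 !K1E jet_posDZ jet_velDZ.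
  by rewrite Zp Zv !scaler0 !add0r.
(* The acceleration of the base jet enters [K2] only through one term, linear in it: half its
   contraction by Γ with the position part x' of X. *)
have DK2 : 'D_Z (fun y => K2 G y X) (w t) =
    2^-1 *: connection_form G (x t) (derive1 x t) z.
  apply: derive_line => h.
  have Dh : jet_dom D (h *: Z + w t) by rewrite /jet_dom /= jet_posDZ Zp scaler0 add0r.
  rewrite (K2E GD _ Dh) (K2E GD _ Dw) !K1E jet_posDZ jet_velDZ jet_accDZ.
  rewrite Zp Zv Za !scaler0 !add0r wp wv wa Xp.
  rewrite (connection_formC GD (h *: z + _) _ (xUD Ut)).
  rewrite (connection_formDr _ _ _ (h *: z)) (connection_formZr _ _ h).
  rewrite (connection_formC GD (derive1n 2 x t) _ (xUD Ut)).
  have aux (A B C E F H : 'rV[R]_n) : 2^-1 *: (A + (B + (h *: C + E) + F) + H) =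
      2^-1 *: (A + (B + E + F) + H) + h *: (2^-1 *: C).
    by apply/rowP => k; rewrite !mxE; ring.
  exact: aux.
rewrite DK1 DK2 (K2_jet_curve Ut) /g metric_form0r mulr0 add0r.
rewrite metric_formZl metric_formZr.
set a := metric_form _ (J2 t) z; set b := metric_form _ (J1 t) _; lra.
Qed.

(** The squared speed of w is |x'|^2 + |J|^2 + |J1|^2 / 4 and is constant. The derivative of the
    last term is a multiple of g(J2, J1), hence zero, so half of the total derivative is the
    left-hand side. *)
Let speed_derive t : U t -> g t (J t) (derive1 x t) + g t (J1 t) (J t) = 0.
Proof.
move=> Ut; have sw1 := smooth_on_derive1 sw.
have S0 : derive1 (fun s => metric_form (S (w s)) (derive1 w s) (derive1 w s)) t = 0.
  have E := derive1_metric_form SD sw jet_curve_dom sw1 sw1 Ut.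
  by rewrite E (w_geod (mem_set Ut)) metric_form0l metric_form0r addr0.
move: S0; rewrite derive1E.
rewrite (@near_eq_derive _ _ _ _ (fun s => g s (derive1 x s) (derive1 x s) +
    g s (J s) (J s) + g s (J1 s) (4^-1 *: J1 s))); last first.
  apply: filterS (open_nbhs_nbhs (conj oU Ut)) => s Us.
  rewrite (sasaki_jet_curve _ Us) (K1_jet_curve Us) (K2_jet_curve Us).
  have [-> _ _] := derive1_jet_curveE Us; congr (_ + _).
  by rewrite /g metric_formZl !metric_formZr mulrA -invfM -natrM.
have s4 : smooth_on U (fun s => 4^-1 *: J1 s).
  apply: smooth_on_row => // j; under eq_fun do rewrite mxE.
  by apply: smooth_onM; [exact: smooth_onC|exact: smooth_on_row_coord].
have H := is_deriveD (is_deriveD (dg sx1 sx1 Ut) (dg sJ sJ Ut)) (dg sJ1 s4 Ut).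
rewrite (@derive_val _ _ _ _ _ _ _ H) -/J -/J1 -/J2 (cov_derive3_eq0 Ut).
have -> : cov_derive G x (fun s => 4^-1 *: J1 s) t = 4^-1 *: J2 t.
  rewrite /J2 /cov_derive connection_formZr scalerDr; congr (_ + _).
  by rewrite !derive1E deriveZ//; exact: smooth_on_derivable sJ1 Ut.
rewrite (cov_derive3_eq0 Ut) scaler0 /g metric_form0l metric_form0r !addr0 -/(g t).
rewrite (gC (derive1 x t) (J t) Ut) (gC (J t) (J1 t) Ut).
set a := g t (J t) _; set b := g t (J1 t) _; lra.
Qed.

Let J1_eq0 t : U t -> J1 t = 0.
Proof.
have E1 s : U s -> g s (J1 s) (derive1 x s) + g s (J s) (J s) + g s (J1 s) (J1 s) = 0.
  move=> Us; have H := is_deriveD (dg sJ sx1 Us) (dg sJ1 sJ Us).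
  have := derive_eq0 (fun r rU => speed_derive (set_mem rU)) Us H.
  by rewrite -/J -/J1 -/J2 (cov_derive3_eq0 Us) /g metric_form0l add0r.
(* With J2 = 0 the derivative of [E1] is 3 g(J1, J): one copy from g(J1, x') and two from |J|^2. *)
have E2 s : U s -> g s (J1 s) (J s) = 0.
  move=> Us.
  have H := is_deriveD (is_deriveD (dg sJ1 sx1 Us) (dg sJ sJ Us)) (dg sJ1 sJ1 Us).
  have := derive_eq0 (fun r rU => E1 r (set_mem rU)) Us H.
  rewrite -/J -/J1 -/J2 (cov_derive3_eq0 Us) /g !metric_form0l metric_form0r -/(g s).
  rewrite (gC (J s) (J1 s) Us); set a := g s (J1 s) _. lra.
move=> Ut; apply: (metric_eq0 GD (xUD Ut)).
have := derive_eq0 (fun r rU => E2 r (set_mem rU)) Ut (dg sJ1 sJ Ut).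
by rewrite -/J -/J1 -/J2 (cov_derive3_eq0 Ut) /g metric_form0l add0r.
Qed.

Lemma geodesic_of_jet_geodesic t : U t -> cov_derive G x (derive1 x) t = 0.
Proof.
move=> Ut; apply: (metric_eq0 GD (xUD Ut)).
(* The relation [speed_derive] is differentiated once more; now that J1 and J2 vanish, only |J|^2
   survives. *)
have H := is_deriveD (dg sJ sx1 Ut) (dg sJ1 sJ Ut).
have := derive_eq0 (fun r rU => speed_derive (set_mem rU)) Ut H.
rewrite -/J -/J1 -/J2 (cov_derive3_eq0 Ut) (J1_eq0 Ut) /g !metric_form0l.
by rewrite !addr0 add0r.
Qed.

End Forward.

(** In [derive_sasaki] the derivatives of [K1] and [K2] are paired with K1(w') = J and K2(w') = J1 /
    2, which are zero. What is left is the Euler-Lagrange expression of x in the direction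
    [jet_pos Z], and it vanishes. *)
Lemma jet_geodesic_of_geodesic :
  {in U, forall t, cov_derive G x (derive1 x) t = 0} ->
  {in U, forall t, cov_derive S w (derive1 w) t = 0}.
Proof.
move=> x_geod t /set_mem Ut.
have J0 s : U s -> J s = 0 by move=> Us; apply: x_geod; rewrite inE.
have J10 s : U s -> J1 s = 0.
  move=> Us; rewrite /J1 (@cov_derive_near _ _ _ x x J (cst 0)).
  - by rewrite /cov_derive derive1_cst add0r connection_form0r.
  - by apply: filterS (open_nbhs_nbhs (conj oU Us)).
  - by apply: filterS (open_nbhs_nbhs (conj oU Us)); exact: J0.
apply: (metric_eq0 SD (jet_curve_dom Ut)).
(* The acceleration of w is paired with an arbitrary constant Z, as the Euler-Lagrange identity
   requires. *)
move: {2}(cov_derive S w (derive1 w) t) => Z.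
rewrite (euler_lagrange SD Z sw jet_curve_dom Ut) (derive_sasaki _ _ Ut).
rewrite (K1_jet_curve Ut) (K2_jet_curve Ut) (J0 _ Ut) (J10 _ Ut) scaler0.
have [-> _ _] := derive1_jet_curveE Ut.
rewrite derive1E.
rewrite (@near_eq_derive _ _ _ _ (fun s => g s (derive1 x s) (jet_pos Z))); last first.
  apply: filterS (open_nbhs_nbhs (conj oU Ut)) => s Us.
  by rewrite (sasaki_jet_curve _ Us) (J0 _ Us) (J10 _ Us) scaler0 /g !metric_form0l !addr0.
rewrite (@derive_val _ _ _ _ _ _ _ (dg sx1 (smooth_onC (jet_pos Z) oU) Ut)).
rewrite -/J (J0 _ Ut) /g !metric_form0l.
rewrite {1}/cov_derive derive1_cst (connection_formC GD _ _ (xUD Ut)).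
by rewrite !add0r !mulr0 !addr0 mulKf ?pnatr_eq0// subrr.
Qed.

End JetCurve.

(** * Jet lifts *)

Section JetLift.
Context {R : realType}.

Lemma derive_translate (V W : normedModType R) (f : V -> W) a x v :
  'D_v (fun y => f (a + y)) x = 'D_v f (a + x).
Proof.
suff E : (fun h : R => h^-1 *: (((fun y => f (a + y)) \o shift x) (h *: v) - f (a + x))) =
    (fun h : R => h^-1 *: ((f \o shift (a + x)) (h *: v) - f (a + x))).
  by rewrite /derive E.
by apply/funext => h /=; rewrite addrCA.
Qed.

Lemma smooth_on_translate (V W : normedModType R) (U : set V) (f : V -> W) a :
  smooth_on U f -> smooth_on (+%R a @^-1` U) (fun y => f (a + y)).
Proof.
have da x : differentiable (+%R a : V -> V) x.
  exact: (differentiableD (differentiable_cst a x) (@ex_diff _ _ _ _ _ id id _)).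
move=> [oU fU]; split=> [|k].
  by apply: open_comp oU => x _; exact/differentiable_continuous/da.
have {fU} := fU k; elim: k f => [|k IHk] f [df Df];
  (split=> [x Ux|]; first exact: (differentiable_comp (da x) (df _ Ux))).
  by [].
move=> v; have -> : 'D_v (fun y => f (a + y)) = fun y => 'D_v f (a + y).
  by apply/funext => x; exact: derive_translate.
exact: (IHk _ (Df v)).
Qed.

Context {n : nat} {M : smoothManifold R n}.

Lemma smooth_curve_translate (q : R -> M) t :
  smooth_curve_at (@charts R n M) q t ->
  smooth_curve_at (@charts R n M) (fun s => q (t + s)) 0.
Proof.
move=> qt i; rewrite addr0 => /qt[U [Ut UD] qU].
exists (+%R t @^-1` U); first by split=> [|s Us]; [rewrite /= addr0|exact: UD].
exact: (smooth_on_translate t qU).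
Qed.

Lemma T2_proj_jet_lift (q : R -> M) t :
  smooth_curve_at (@charts R n M) q t -> T2_proj (jet_lift q t) = q t.
Proof.
move=> /smooth_curve_translate/jet2_reprP[_ + _].
by rewrite /T2_proj /jet_lift => ->; rewrite addr0.
Qed.

(** Smoothness of q at t rules out the default jet of [jet2], and derivatives at 0 of the translated
    curve are derivatives of q at t. *)
Lemma T2_charts_jet_lift (q : R -> M) i t :
  smooth_curve_at (@charts R n M) q t -> chart_dom (charts i) (q t) ->
  T2_charts i (jet_lift q t) = jet_curve (charts i \o q) t.
Proof.
move=> /smooth_curve_translate qt qi.
have qi0 : chart_dom (charts i) (q (t + 0)) by rewrite addr0.
rewrite /jet_lift (T2_charts_jet2 qt qi0).
have d1 (f : R -> 'rV[R]_n) : derive1 (fun s => f (t + s)) = fun s => derive1 f (t + s).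
  by apply/funext => s; rewrite !derive1E derive_translate.
rewrite /jet_coord /jet_curve.
have -> : charts i \o (fun s => q (t + s)) = fun s => (charts i \o q) (t + s) by [].
by move: (charts i \o q) => f; rewrite /derive1n /= !d1 addr0.
Qed.

Lemma metric_on_chart (g : riemannianMetric M) i :
  metric_on (charts i @` chart_dom (charts i)) (g i).
Proof.
split; first exact: chart_image_open.
- exact: metric_smooth.
- exact: Defs.metric_sym.
- exact: metric_posdef.
Qed.

End JetLift.

Theorem mainTheorem3 (R : realType) (n : nat) (M : smoothManifold R n)
    (g : riemannianMetric M) (I : set R) (q : R -> M) :
  open I -> is_interval I -> smooth_curve_on (@charts R n M) I q ->
  geodesic_on (@T2_charts R n M) (sasaki_metric g) I (jet_lift q) <->
  geodesic_on (@charts R n M) g I q.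
Proof.
move=> oI _ qI.
(* Around each time, an open set of times inside I on which q stays in one chart and is smooth
   there: the setting of the local results. *)
have loc t i : I t -> chart_dom (charts i) (q t) -> exists U : set R,
    [/\ U t, U `<=` I, U `<=` q @^-1` chart_dom (charts i) &
        smooth_on U (charts i \o q)].
  move=> It qti; have [U [Ut UD] qU] := qI t It i qti.
  exists (U `&` I); split; [by split|by move=> s []|by move=> s [/UD]|].
  by apply: (smooth_on_subset _ _ qU) => [|s []//]; exact: openI qU.1 oI.
have imD i (U : set R) : U `<=` q @^-1` chart_dom (charts i) ->
    {homo charts i \o q : s / U s >-> (charts i @` chart_dom (charts i)) s}.
  by move=> UD s /UD ?; exists (q s).
(* The induced chart reads the jet lift as the coordinate jet curve on all of U, so the two geodesic
   expressions agree. *)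
have cov_jet i (U : set R) s : open U -> U `<=` I ->
    U `<=` q @^-1` chart_dom (charts i) -> U s ->
    cov_derive (sasaki_metric g i) (T2_charts i \o jet_lift q)
      (derive1 (T2_charts i \o jet_lift q)) s =
    cov_derive (sasaki_coef (g i)) (jet_curve (charts i \o q))
      (derive1 (jet_curve (charts i \o q))) s.
  move=> oU UI UD; apply: cov_derive_velocity_eq oU _ => r /set_mem Ur.
  by apply: T2_charts_jet_lift; [exact/qI/UI|exact: UD].
have dom_jet i t : I t ->
    chart_dom (T2_charts i) (jet_lift q t) = chart_dom (charts i) (q t).
  by move=> It; rewrite /= T2_proj_jet_lift//; exact: qI.
split=> [[_ Jgeod]|[_ qgeod]]; split=> //.
- move=> t i It qti; have [U [Ut UI UD qU]] := loc t i It qti.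
  apply: (geodesic_of_jet_geodesic (metric_on_chart g i) qU (imD i U UD) _ Ut).
  move=> s /set_mem Us; rewrite -(cov_jet i U s qU.1 UI UD Us).
  by apply: Jgeod; [exact: UI|rewrite dom_jet; [exact: UD|exact: UI]].
(* A geodesic must also be a smooth curve; for the jet lift this follows from the smoothness of q in
   the chart below. *)
- move=> t It i; rewrite dom_jet// => qti.
  have [U [Ut UI UD qU]] := loc t i It qti; exists U.
    by split=> // s Us; rewrite /preimage /mkset dom_jet; [exact: UD|exact: UI].
  apply: smooth_on_eq (smooth_on_jet_curve qU) => s /set_mem Us.
  by apply/esym/T2_charts_jet_lift; [exact/qI/UI|exact: UD].
- move=> t i It; rewrite dom_jet// => qti.
  have [U [Ut UI UD qU]] := loc t i It qti.
  rewrite (cov_jet i U t qU.1 UI UD Ut).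
  apply: (jet_geodesic_of_geodesic (metric_on_chart g i) qU (imD i U UD));
    last exact: mem_set.
  by move=> s /set_mem Us; apply: qgeod; [exact: UI|exact: UD].
Qed.
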